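(* Assume that $p/n_j \to y_j \in (0,\infty)$ for $j=1,2$, and that $\Delta=\sqrt{(\mu_1-\mu_2)^{T}\Sigma^{-1}(\mu_1-\mu_2)}$ is a constant. Then the misclassification rate $$R_{\mathrm{LDA1}} = \frac{1}{2}\sum_{j=1}^2 \Phi\left(\frac{(-1)^j\left(\mu_j-\frac{\bar{X}_1+\bar{X}_2}{2}\right)^{T} \Sigma^{-1}(\bar{X}_1-\bar{X}_2)}{\sqrt{(\bar{X}_1-\bar{X}_2)^{T} \Sigma^{-1}(\bar{X}_1-\bar{X}_2)}}\right)$$ satisfies $$R_{\mathrm{LDA1}} \xrightarrow{\;p\;} \frac{1}{2}\, \Phi\left(- \frac{\Delta^2+y_2-y_1}{2\sqrt{\Delta^2+y_1+y_2}}\right)+\frac{1}{2}\,\Phi\left(- \frac{\Delta^2+y_1-y_2}{2\sqrt{\Delta^2+y_1+y_2}}\right).$$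
   Context: Setting (asymptotic along a sequence of problems with $p,n_1,n_2\to\infty$): $\mu_1\neq\mu_2$ are vectors in $\mathbb{R}^p$ and $\Sigma$ is a $p\times p$ (invertible) covariance matrix, all allowed to depend on $p$. $\{X_{1,j}\}_{j=1}^{n_1}$ and $\{X_{2,j}\}_{j=1}^{n_2}$ are independent i.i.d. samples from $N_p(\mu_1,\Sigma)$ and $N_p(\mu_2,\Sigma)$ respectively, and $\bar X_k=\frac{1}{n_k}\sum_{j=1}^{n_k}X_{k,j}$, $k=1,2$. $\Phi$ is the standard normal distribution function and $\xrightarrow{p}$ denotes convergence in probability. The quantity $\Delta$ is assumed to be a constant (not depending on $p,n_1,n_2$). $R_{\mathrm{LDA1}}$ is the misclassification rate, conditional on the samples and with equal weights $1/2$ on the two types of error, of the classifier that assigns a new independent observation $X$ to class 1 if and only if $\left(X-\frac{\bar X_1+\bar X_2}{2}\right)^{T}\Sigma^{-1}(\bar X_1-\bar X_2)>0$, where $X$ belongs to class $k$ if $X\sim N(\mu_k,\Sigma)$. *)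

(* Defs.v *)
From HB Require Import structures.
From mathcomp Require Import all_boot all_order all_algebra.
From mathcomp Require Import all_classical all_reals all_analysis.

Set Implicit Arguments.
Unset Strict Implicit.
Unset Printing Implicit Defensive.

Import Order.TTheory GRing.Theory Num.Theory.
Import numFieldNormedType.Exports.

Local Open Scope classical_set_scope.
Local Open Scope ring_scope.

(* x^T A y; the library's product of a row by a column is a 1 x 1 matrix. *)
Definition bilin (R : realType) (p : nat) (x : 'cV[R]_p) (A : 'M[R]_p)
    (y : 'cV[R]_p) : R :=
  (x^T *m A *m y) 0 0.

Definition covariance_matrix (R : realType) (p : nat) (S : 'M[R]_p) : Prop :=
  S^T = S /\ forall a : 'cV[R]_p, 0 <= bilin a S a.

Definition Phi (R : realType) (x : R) : R :=
  fine (normal_prob (0 : R) 1 `]-oo, x]).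

(* N(m, v), parametrised by its variance v.  The degenerate case is separate
   because [normal_prob m 0] is not the Dirac mass at m (it is uniform). *)
Definition normal_law (R : realType) (m v : R) (B : set R) : \bar R :=
  if v == 0 then dirac m B else normal_prob m (Num.sqrt v) B.

(* X ~ N_p(mu, S): X is a random vector all of whose linear combinations are
   univariate normal, a^T X ~ N(a^T mu, a^T S a). *)
Definition normal_vector (R : realType) (d : measure_display)
    (T : measurableType d) (P : probability T R) (p : nat)
    (X : T -> 'cV[R]_p) (mu : 'cV[R]_p) (S : 'M[R]_p) : Prop :=
  (forall i : 'I_p, measurable_fun setT (fun w => X w i 0)) /\
  (forall (a : 'cV[R]_p) (B : set R), measurable B ->
    P [set w | B ((a^T *m X w) 0 0)] =
    normal_law ((a^T *m mu) 0 0) (bilin a S a) B).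

(* Mutual independence of finitely many random vectors, through the
   sigma-algebras generated by their coordinates. *)
Definition independent_vectors (R : realType) (d : measure_display)
    (T : measurableType d) (P : probability T R) (p : nat) (I : finType)
    (X : I -> T -> 'cV[R]_p) : Prop :=
  forall (J : {set I}) (A : I -> set T),
    (forall i, i \in J ->
       g_sigma_preimage (fun (k : 'I_p) (w : T) => X i w k 0) (A i)) ->
    P (\bigcap_(i in [set i | i \in J]) A i) = (\prod_(i in J) P (A i))%E.

Definition two_samples (I1 I2 U : Type) (X1 : I1 -> U) (X2 : I2 -> U)
    (i : I1 + I2) : U :=
  match i with inl j => X1 j | inr j => X2 j end.

Definition sample_mean (R : realType) (p n : nat) (U : Type)
    (X : 'I_n -> U -> 'cV[R]_p) (w : U) : 'cV[R]_p :=
  n%:R^-1 *: \sum_(j < n) X j w.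

Definition lda1_class1 (R : realType) (p : nat) (S : 'M[R]_p)
    (x1 x2 x : 'cV[R]_p) : bool :=
  0 < bilin (x - 2^-1 *: (x1 + x2)) (invmx S) (x1 - x2).

(* Misclassification rate given that the sample means are x1 and x2, for a new
   observation Y1 (if from class 1) or Y2 (if from class 2).  Since the new
   observation is independent of the samples, conditioning on the samples
   amounts to holding x1 and x2 fixed: the randomness left, under Q, is that of
   the new observation only. *)
Definition lda1_rate (R : realType) (d : measure_display)
    (T : measurableType d) (Q : probability T R) (p : nat)
    (Y1 Y2 : T -> 'cV[R]_p) (S : 'M[R]_p) (x1 x2 : 'cV[R]_p) : R :=
  2^-1 * fine (Q [set w | ~~ lda1_class1 S x1 x2 (Y1 w)]) +
  2^-1 * fine (Q [set w | lda1_class1 S x1 x2 (Y2 w)]).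

Definition lda1_formula (R : realType) (p : nat) (mu1 mu2 : 'cV[R]_p)
    (S : 'M[R]_p) (x1 x2 : 'cV[R]_p) : R :=
  let term (j : nat) (mu : 'cV[R]_p) :=
    Phi ((-1) ^+ j * bilin (mu - 2^-1 *: (x1 + x2)) (invmx S) (x1 - x2)
         / Num.sqrt (bilin (x1 - x2) (invmx S) (x1 - x2))) in
  2^-1 * (term 1%N mu1 + term 2%N mu2).

(* Convergence in probability to a constant; the m-th variable may live on its
   own probability space. *)
Definition cvg_in_probability (R : realType) (d : nat -> measure_display)
    (T : forall m, measurableType (d m)) (P : forall m, probability (T m) R)
    (Z : forall m, T m -> R) (c : R) : Prop :=
  (forall m, measurable_fun setT (Z m)) /\
  (forall eps : R, 0 < eps ->
    P m [set w | eps <= `|Z m w - c|] @[m --> \oo] --> 0%E).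

(* Main.v *)
Require Import Defs.
From HB Require Import structures.
From mathcomp Require Import all_boot all_order all_algebra.
From mathcomp Require Import all_classical all_reals all_analysis.
From mathcomp Require Import measurable_realfun ring lra.

Import Order.TTheory GRing.Theory Num.Theory.
Import numFieldNormedType.Exports.

Local Open Scope classical_set_scope.
Local Open Scope ring_scope.

(* Write e_k for the error (mean of sample k) - mu_k, <x, y> = x^T S^-1 y and
   delta = mu1 - mu2.  Each argument of Phi is U / sqrt V, with U and V linear
   in |delta|^2, <delta, e_k>, |e_k|^2 and |e_1 - e_2|^2 (the cross term
   <e_1, e_2> is absorbed in the last one).  The random ones concentrate in L^2,
   hence in probability by Chebyshev: a e_1 + b e_2 is a weighted sum of
   independent centred vectors, so each of its linear forms has the first four
   moments of a normal law, of variance proportional to s = a^2/n1 + b^2/n2;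
   hence E <delta, e>^2 = s |delta|^2 -> 0 and, after whitening S,
   E (|e|^2 - s p)^2 = 2 p s^2 -> 0 while s p -> a^2 y1 + b^2 y2. *)

Set Implicit Arguments.
Unset Strict Implicit.
Unset Printing Implicit Defensive.

(** * Whitening of a covariance matrix *)

Section bilinear_forms.
Context {R : realType}.

(** Normality of a vector is given only through its linear forms, one at a time: no joint density of
    coordinates is used and no convolution of normal laws is computed. What travels through the
    proof is the list of the first four moments, which independent sums preserve by binomial
    expansion; four suffice because Chebyshev is applied to a quantity of degree 2. Likewise the
    whitened coordinates z_i are never shown to be independent: the variance of the sum of their
    squares involves only pairs, and these are reached through the linear forms z_i + z_j and z_i -
    z_j. The quadratic errors do not vanish: |e_k|^2 is a sum of p squares of mean 1/n_k, which
    leaves y_k in the limit. This is the source of every y_k in the statement. The formula for the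
    rate is an exact identity at fixed sample means, proved apart from the limit. *)

Lemma bilinDl p (x y : 'cV[R]_p) A z :
  bilin (x + y) A z = bilin x A z + bilin y A z.
Proof. by rewrite /bilin linearD !mulmxDl mxE. Qed.

Lemma bilinDr p (x y : 'cV[R]_p) A z :
  bilin z A (x + y) = bilin z A x + bilin z A y.
Proof. by rewrite /bilin mulmxDr mxE. Qed.

Lemma bilinZl p a (x : 'cV[R]_p) A z : bilin (a *: x) A z = a * bilin x A z.
Proof. by rewrite /bilin linearZ -!scalemxAl mxE. Qed.

Lemma bilinZr p a (x : 'cV[R]_p) A z : bilin z A (a *: x) = a * bilin z A x.
Proof. by rewrite /bilin -scalemxAr mxE. Qed.

Lemma bilinNl p (x : 'cV[R]_p) A z : bilin (- x) A z = - bilin x A z.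
Proof. by rewrite -scaleN1r bilinZl mulN1r. Qed.

Lemma bilinNr p (x : 'cV[R]_p) A z : bilin z A (- x) = - bilin z A x.
Proof. by rewrite -scaleN1r bilinZr mulN1r. Qed.

Lemma bilinC p (A : 'M[R]_p) x y : A^T = A -> bilin x A y = bilin y A x.
Proof.
move=> AT; rewrite /bilin -[in LHS](trmxK (x^T *m A *m y)) mxE.
by rewrite !trmx_mul trmxK AT mulmxA.
Qed.

Lemma bilin_mulmx p q (x y : 'cV[R]_p) (L : 'M[R]_(q, p)) (A : 'M[R]_q) :
  bilin (L *m x) A (L *m y) = bilin x (L^T *m A *m L) y.
Proof. by rewrite /bilin trmx_mul !mulmxA. Qed.

Lemma bilin1 p (x y : 'cV[R]_p) : bilin x 1%:M y = \sum_i x i 0 * y i 0.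
Proof.
by rewrite /bilin mulmx1 mxE; apply: eq_bigr => i _; rewrite !mxE.
Qed.

Lemma bilin1_eq0 p (x : 'cV[R]_p) : bilin x 1%:M x = 0 -> x = 0.
Proof.
rewrite bilin1 => /eqP; rewrite psumr_eq0 => [/allP x0|i _]; last first.
  by rewrite -expr2 sqr_ge0.
apply/colP => i; rewrite mxE; apply/eqP.
have /implyP/(_ erefl) := x0 i (mem_index_enum i).
by rewrite -expr2 sqrf_eq0.
Qed.

Definition posdef p (S : 'M[R]_p) :=
  S^T = S /\ forall a : 'cV[R]_p, a != 0 -> 0 < bilin a S a.

(** Near 0 the linear term dominates, so a positive slope would give a negative value at a small
    negative [t]. *)
Lemma nonneg_parabola_slope (q r : R) : 0 <= q -> 0 <= r ->
  (forall t, 0 <= 2 * t * r + t ^+ 2 * q) -> r = 0.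
Proof.
move=> q0 r0 N; apply/eqP; rewrite eq_le r0 andbT leNgt; apply/negP => rpos.
(* The minimiser is [- r / q]; the [+ 1] keeps the denominator positive when [q = 0], and the value
   is still negative. *)
have := N (- (r / (q + 1))); rewrite leNgt => /negP; apply.
have -> : 2 * - (r / (q + 1)) * r + (- (r / (q + 1))) ^+ 2 * q =
  - (r ^+ 2 * (q + 2) / (q + 1) ^+ 2) by field; lra.
by rewrite oppr_lt0 divr_gt0 ?mulr_gt0 ?exprn_gt0//; lra.
Qed.

(** An isotropic vector of a semidefinite form lies in its kernel: moving [a] by [t] times [b = S a]
    changes the form by [2 t |b|^2 + t^2 b^T S b], which is nonnegative for all [t] only if [b = 0].
    Invertibility then gives [a = 0]. *)
Lemma covariance_matrix_posdef p (S : 'M[R]_p) :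
  covariance_matrix S -> S \in unitmx -> posdef S.
Proof.
move=> [ST S_ge0] Su; split => // a a0; rewrite lt_neqAle S_ge0 andbT.
apply: contra_neq a0 => /esym aSa.
pose b := S *m a.
have bSa : bilin b S a = bilin b 1%:M b by rewrite /bilin /b mulmx1 mulmxA.
have q_ge0 := S_ge0 b.
have N t : 0 <= 2 * t * bilin b 1%:M b + t ^+ 2 * bilin b S b.
  have := S_ge0 (a + t *: b).
  rewrite bilinDl !bilinDr !bilinZl !bilinZr aSa bSa (bilinC a _ ST) bSa.
  by congr (_ <= _); ring.
have b_ge0 : 0 <= bilin b 1%:M b.
  by rewrite bilin1 sumr_ge0// => i _; rewrite -expr2 sqr_ge0.
have b0 := nonneg_parabola_slope q_ge0 b_ge0 N.
have {}b0 := bilin1_eq0 b0.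
by rewrite -(mulKmx Su a) -/b b0 mulmx0.
Qed.

Lemma posdef_congr p (S : 'M[R]_p) (L : 'M[R]_p) :
  L \in unitmx -> posdef S -> posdef (L *m S *m L^T).
Proof.
move=> Lu [ST S_gt0]; split=> [|a a0].
  by rewrite !trmx_mul trmxK ST mulmxA.
rewrite -{1}(trmxK L) -bilin_mulmx; apply: S_gt0.
apply: contra_neq a0 => La0.
by rewrite -(mulKmx (_ : L^T \in unitmx) a) ?unitmx_tr// La0 mulmx0.
Qed.

(** Block elimination by induction on the dimension: clear the first column with the pivot [s > 0],
    whiten the Schur complement, which is again positive definite, and rescale the pivot by
    [1 / sqrt s]. The resulting [A] is the inverse of the Cholesky factor of [S]. *)
Lemma posdef_whitening p (S : 'M[R]_p) :
  posdef S -> exists A : 'M[R]_p, A *m S *m A^T = 1%:M.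
Proof.
elim: p S => [|p IHp] S; first by exists 1%:M; apply/matrixP => -[].
rewrite -[p.+1]/(1 + p)%N in S *; move=> Spd.
have [ST S_gt0] := Spd.
pose s : R := ulsubmx S 0 0.
have ulS : ulsubmx S = s%:M by rewrite [LHS]mx11_scalar.
have s_gt0 : 0 < s.
  have := S_gt0 (col_mx 1%:M 0).
  rewrite /bilin tr_col_mx -(submxK S) mul_row_block mul_row_col.
  rewrite trmx0 !mul0mx !mulmx0 trmx1 mul1mx !addr0 mulmx1 ulS mxE mulr1n.
  apply; apply/eqP => /colP/(_ (lshift p 0)).
  by rewrite (@col_mxEu _ 1 p 1) !mxE => /eqP; rewrite oner_eq0.
have urS : ursubmx S = (dlsubmx S)^T by rewrite trmx_dlsub ST.
pose b := dlsubmx S.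
pose L : 'M[R]_(1 + p) := block_mx 1%:M 0 (- s^-1 *: b) 1%:M.
have Lu : L \in unitmx by rewrite unitmxE det_lblock !det1 mulr1 unitr1.
have LSL : L *m S *m L^T =
    block_mx s%:M 0 0 (drsubmx S - s^-1 *: (b *m b^T)).
  rewrite /L -[in LHS](submxK S) tr_block_mx !mulmx_block.
  rewrite !(trmx0, trmx1, mul1mx, mulmx1, mul0mx, mulmx0, addr0, add0r).
  rewrite ulS urS -/b mul_scalar_mx.
  have e1 : - s^-1 *: b *m s%:M + b = 0.
    by rewrite mul_mx_scalar scalerA mulrN mulfV ?gt_eqF// scaleN1r addNr.
  have e2 : s *: (- s^-1 *: b)^T + b^T = 0.
    by rewrite linearZ/= scalerA mulrN mulfV ?gt_eqF// scaleN1r addNr.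
  congr block_mx => //.
  by rewrite e1 mul0mx add0r addrC -scalemxAl scaleNr.
have := posdef_congr Lu Spd; rewrite LSL => -[QT Q_gt0].
have /IHp[A AQA] : posdef (drsubmx S - s^-1 *: (b *m b^T)).
  split=> [|a a0].
    by move: QT; rewrite tr_block_mx => /eq_block_mx[].
  (* Vectors with first entry 0 see only the Schur complement. *)
  have := Q_gt0 (col_mx 0 a).
  rewrite /bilin tr_col_mx mul_row_block mul_row_col.
  rewrite trmx0 !mul0mx !mulmx0 !add0r; apply.
  by rewrite col_mx_eq0 negb_and a0 orbT.
pose B : 'M[R]_(1 + p) := block_mx ((Num.sqrt s)^-1)%:M 0 0 A.
exists (B *m L); rewrite trmx_mul -!mulmxA.
rewrite (_ : B *m _ = B *m (L *m S *m L^T) *m B^T) ?LSL; last first.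
  by rewrite -LSL !mulmxA.
rewrite /B tr_block_mx !mulmx_block.
rewrite !(trmx0, mul0mx, mulmx0, addr0, add0r) AQA tr_scalar_mx.
rewrite -!scalar_mxM [RHS]scalar_mx_block; congr block_mx; congr scalar_mx.
rewrite mulrAC -expr2 exprVn sqr_sqrtr ?ltW//.
by rewrite mulVf// gt_eqF.
Qed.

(** The second identity turns [x^T S^-1 x] into the Euclidean square of [A x]. It holds because a
    one-sided inverse of a square matrix is two-sided: [A (S A^T) = 1] gives [S (A^T A) = 1]. *)
Lemma covariance_whitening p (S : 'M[R]_p) :
    covariance_matrix S -> S \in unitmx ->
  exists A : 'M[R]_p, A *m S *m A^T = 1%:M /\ invmx S = A^T *m A.
Proof.
move=> Scov Su.
have [A ASA] := posdef_whitening (covariance_matrix_posdef Scov Su).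
exists A; split => //.
have /mulmx1C : A *m (S *m A^T) = 1%:M by rewrite mulmxA.
by rewrite -mulmxA => SAA; rewrite -(mulKmx Su (A^T *m A)) SAA mulmx1.
Qed.

End bilinear_forms.

(** * The normal law and its moments *)

Section normal.
Context {R : realType}.
Local Notation mu := (@lebesgue_measure R).
Local Notation phi := (@normal_pdf R 0 1).


Lemma is_derive_affine (m s x : R) :
  is_derive x 1 (fun y : R => (y - m) / s) s^-1.
Proof.
apply: is_derive_eq.
by rewrite scaler0 add0r subr0 scaler1.
Qed.

Lemma derive1_affine (m s : R) :
  (fun y : R => (y - m) / s)^`()%classic = cst s^-1.
Proof.
by apply/funext => x; rewrite derive1E; have [_ ->] := is_derive_affine m s x.
Qed.

Lemma normal_pdf_affine (m s x : R) : 0 < s ->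
  normal_pdf m s x = phi ((x - m) / s) * s^-1.
Proof.
move=> s0.
rewrite !normal_pdfE ?gt_eqF// /normal_peak /normal_fun.
rewrite subr0 expr1n mul1r -mulrnAr sqrtrM ?sqr_ge0// sqrtr_sqr gtr0_norm//.
rewrite invfM -mulrA [RHS]mulrC; congr (_ * (_ * expR _)).
by rewrite exprMn exprVn -mulr_natr invfM mulNr mulNr mulrA; congr (- _).
Qed.

Lemma integral_normal_pdfM (m s : R) (f : R -> R) : 0 < s -> continuous f ->
  (forall x, 0 <= f x) ->
  (\int[mu]_x (f ((x - m) / s) * normal_pdf m s x)%:E =
   \int[mu]_x (f x * phi x)%:E)%E.
Proof.
move=> s0 cf f0.
have e : (0 : R) < s^-1 by rewrite invr_gt0.
rewrite [RHS](increasing_ge0_integration_by_substitutionT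
  (F := fun y : R => (y - m) / s)).
- apply: eq_integral => x _; congr EFin.
  by rewrite derive1_affine/= normal_pdf_affine// mulrA.
- by move=> x y xy; rewrite ltr_pM2r ?ltr_leB.
- by rewrite derive1_affine => ?; exact: cvg_cst.
- by rewrite derive1_affine; exact: is_cvg_cst.
- by rewrite derive1_affine; exact: is_cvg_cst.
- by move=> x; have [] := is_derive_affine m s x.
- by apply/gt0_cvgMlNy => //; exact: cvg_addrr_Ny.
- by apply/gt0_cvgMly => //; exact: cvg_addrr.
- move=> x; apply: continuousM; first exact: cf.
  by apply: continuous_normal_pdf; rewrite oner_eq0.
- by move=> x; rewrite mulr_ge0// normal_pdf_ge0.
Qed.

Lemma normal_prob_rayE (m s x : R) : 0 < s ->
  normal_prob m s `]-oo, x] = normal_prob 0 1 `]-oo, (x - m) / s].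
Proof.
move=> s0.
have e : (0 : R) < s^-1 by rewrite invr_gt0.
rewrite /normal_prob.
rewrite [RHS](increasing_ge0_integration_by_substitutionNy
  (F := fun y : R => (y - m) / s)).
- apply: eq_integral => y _; congr EFin.
  by rewrite derive1_affine/= normal_pdf_affine.
- by move=> y z _ _ yz; rewrite ltr_pM2r ?ltr_leB.
- by rewrite derive1_affine => ? _; exact: cvg_cst.
- by rewrite derive1_affine; exact: is_cvg_cst.
- by rewrite derive1_affine; exact: cvg_cst.
- split=> [y _|]; first by have [] := is_derive_affine m s y.
  apply: cvg_at_left_filter; apply: cvgM; last exact: cvg_cst.
  by apply: cvgB; [exact: cvg_id|exact: cvg_cst].
- by apply/gt0_cvgMlNy => //; exact: cvg_addrr_Ny.
- apply: continuous_subspaceT => y.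
  by apply: continuous_normal_pdf; rewrite oner_eq0.
- by move=> y _; rewrite normal_pdf_ge0.
Qed.

Lemma fine_normal_prob_ray (m s x : R) : 0 < s ->
  normal_prob m s `]-oo, x] = (Phi ((x - m) / s))%:E.
Proof.
move=> s0; rewrite normal_prob_rayE// /Phi fineK//.
exact: fin_num_measure.
Qed.

Lemma normal_prob_open_ray (m s x : R) :
  normal_prob m s `]-oo, x[ = normal_prob m s `]-oo, x].
Proof.
rewrite /normal_prob; apply: integral_itv_bndo_bndc.
by apply/measurable_EFinP; apply: measurable_funTS;
  exact: measurable_normal_pdf.
Qed.

Lemma normal_pdf_oppE x : phi (- x) = phi x.
Proof. by rewrite !normal_pdfE ?oner_eq0// /normal_fun !subr0 sqrrN. Qed.

Lemma continuous_phi : continuous phi.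
Proof. by apply: continuous_normal_pdf; rewrite oner_eq0. Qed.

Lemma normal_prob_nonneg : normal_prob 0 1 `[0, +oo[ = (2^-1 : R)%:E.
Proof.
have := @integral_normal_pdf R 0 1.
rewrite ge0_symfun_integralT; last 3 first.
- by move=> x; rewrite normal_pdf_ge0.
- exact: continuous_phi.
- by move=> x /=; rewrite normal_pdf_oppE.
rewrite -set_itvcy -/(normal_prob 0 1 _).
have := fin_num_measure (normal_prob 0 1 : probability _ R) `[0, +oo[%classic.
move=> /(_ (measurable_itv _)) /fineK => <-.
by rewrite -EFinM => -[q1]; congr EFin; lra.
Qed.

(** Supplies the boundary value at 0 of the antiderivatives below, and the error rate when the two
    sample means coincide. *)
Lemma Phi0 : Phi (0 : R) = 2^-1.
Proof.
rewrite /Phi -normal_prob_open_ray.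
have := probability_setC (normal_prob 0 1 : probability _ R)
  (measurable_itv `[(0:R), +oo[).
rewrite /= setCitvr normal_prob_nonneg => ->.
by rewrite /=; lra.
Qed.

Lemma is_derive_Phi (x : R) : is_derive x 1 (@Phi R) (phi x).
Proof.
have fi : mu.-integrable `]-oo, (x + 1)] (EFin \o phi).
  apply: (integrableS _ _ (subsetT _)) => //.
  exact: integrable_normal_pdf.
have x1 : x < x + 1 by rewrite ltrDl.
have [|d dE] := continuous_FTC1 x1 fi _ (continuous_phi (x := x)).
  exact: ltNyr.
by apply: (DeriveDef d); rewrite -derive1E; exact: dE.
Qed.

Lemma is_derive_normal_pdf (x : R) : is_derive x 1 phi (- x * phi x).
Proof.
have -> : phi = (fun y => normal_peak 1 * expR (- (2^-1 * y ^+ 2))).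
  rewrite normal_pdfE ?oner_eq0//; apply/funext => y; congr (_ * expR _).
  by rewrite subr0 expr1n mulrC mulrN.
apply: is_derive_eq.
rewrite /GRing.scale/=.
by field.
Qed.

(** The identity as a random variable under the standard normal law: its distribution function is
    [Phi], which therefore tends to 1. *)
Let idR : measurableTypeR R -> R := idfun.

HB.instance Definition _ :=
  @isMeasurableFun.Build _ _ _ _ idR (@measurable_id _ _ setT).

Lemma is_derive_continuous (f : R -> R) (x a : R) :
  is_derive x 1 f a -> {for x, continuous f}.
Proof.
move=> [df _]; apply: (@differentiable_continuous R R^o R^o).
exact/derivable1_diffP.
Qed.

Lemma cvg_Phi_y : Phi x @[x --> +oo] --> (1 : R).
Proof.
have /fine_cvg := @cvg_cdfy1 _ _ R (normal_prob 0 1) idR.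
exact.
Qed.

Lemma normal_pdf_decay (x : R) : 1 <= x ->
  x ^+ 3 * phi x <= 8 * normal_peak 1 * x^-1.
Proof.
move=> x1; have x0 : 0 < x by exact: lt_le_trans x1.
rewrite ler_pdivlMr// normal_pdfE ?oner_eq0//.
rewrite /normal_fun subr0 expr1n mulNr expRN.
rewrite (_ : _ * x = normal_peak 1 * (x ^+ 4 / expR (x ^+ 2 / 2)));
  last by ring.
rewrite mulrC ler_wpM2r ?normal_peak_ge0// ler_pdivrMr ?expR_gt0//.
(* The quadratic term of the exponential series at [x ^+ 2 / 2] is [x ^+ 4 / 8], whence the constant
   8. *)
have := @expR_ge1Dxn R (x ^+ 2 / 2) 1.
rewrite divr_ge0 ?sqr_ge0// => /(_ isT) e.
apply: le_trans (ler_wpM2l _ e) => //.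
have -> : 2`!%:R = 2 :> R by [].
nra.
Qed.

Lemma cvg_invr_y (c : R) : c * x^-1 @[x --> +oo] --> (0 : R).
Proof.
rewrite -(mulr0 c); apply: cvgM; first exact: cvg_cst.
by apply/gtr0_cvgV0; [exact: nbhs_pinfty_gt|exact: cvg_id].
Qed.

Lemma cvg_cube_normal_pdf : x ^+ 3 * phi x @[x --> +oo] --> (0 : R).
Proof.
apply: (squeeze_cvgr _ (cvg_cst 0) (cvg_invr_y (8 * normal_peak 1))).
near=> x; have x1 : 1 <= x by near: x; exact: nbhs_pinfty_ge.
by rewrite normal_pdf_decay// mulr_ge0 ?normal_pdf_ge0// exprn_ge0//
  (le_trans _ x1).
Unshelve. all: by end_near.
Qed.

Lemma cvg_id_normal_pdf : x * phi x @[x --> +oo] --> (0 : R).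
Proof.
apply: (squeeze_cvgr _ (cvg_cst 0) cvg_cube_normal_pdf).
near=> x; have x1 : 1 <= x by near: x; exact: nbhs_pinfty_ge.
have x0 : 0 <= x by exact: le_trans x1.
rewrite mulr_ge0 ?normal_pdf_ge0//= ler_wpM2r ?normal_pdf_ge0//.
nra.
Unshelve. all: by end_near.
Qed.

Lemma continuous_expr_normal_pdf k : continuous (fun x : R => x ^+ k * phi x).
Proof.
by move=> x; apply: cvgM; [exact: exprn_continuous|exact: continuous_phi].
Qed.

Lemma integral_sqr_normal_pdf :
  (\int[mu]_x (x ^+ 2 * phi x)%:E = 1)%E.
Proof.
rewrite ge0_symfun_integralT; last 3 first.
- by move=> x; rewrite mulr_ge0 ?sqr_ge0 ?normal_pdf_ge0.
- exact: continuous_expr_normal_pdf.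
- by move=> x /=; rewrite normal_pdf_oppE sqrrN.
(* Integration by parts with [phi' = - x phi]; evenness doubles [F(+oo) - F(0) = 1 - 1/2]. *)
pose F : R -> R := @Phi R \- (fun x => x * phi x).
have dF (x : R) : is_derive x 1 F (x ^+ 2 * phi x).
  have dPhi := is_derive_Phi x; have dphi := is_derive_normal_pdf x.
  apply: is_derive_eq; rewrite /GRing.scale/=; ring.
rewrite -set_itvcy (@ge0_continuous_FTC2y _ _ F 0 1).
- by rewrite /F/= mul0r subr0 Phi0 -EFinB -EFinM; congr EFin; field.
- by move=> x _; rewrite mulr_ge0 ?sqr_ge0 ?normal_pdf_ge0.
- by apply: continuous_subspaceT; exact: continuous_expr_normal_pdf.
- by rewrite -[1]subr0; apply: cvgB;
    [exact: cvg_Phi_y|exact: cvg_id_normal_pdf].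
- by move=> x _; have [] := dF x.
- by apply: cvg_at_right_filter; exact: (is_derive_continuous (dF 0)).
- by move=> x _; rewrite derive1E; have [_ ->] := dF x.
Qed.

Lemma integral_exp4_normal_pdf :
  (\int[mu]_x (x ^+ 4 * phi x)%:E = 3%:E)%E.
Proof.
rewrite ge0_symfun_integralT; last 3 first.
- by move=> x; rewrite mulr_ge0 ?exprn_even_ge0 ?normal_pdf_ge0.
- exact: continuous_expr_normal_pdf.
- by move=> x /=; rewrite normal_pdf_oppE; congr (_ * _); ring.
(* Two integrations by parts; the half-line integral is [3 - 3/2]. *)
pose F : R -> R :=
  (fun x => 3 * Phi x) \-
  ((fun x => x ^+ 3 * phi x) \+ (fun x => 3 * (x * phi x))).
have dF (x : R) : is_derive x 1 F (x ^+ 4 * phi x).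
  have dPhi := is_derive_Phi x; have dphi := is_derive_normal_pdf x.
  apply: is_derive_eq; rewrite /GRing.scale/=; ring.
rewrite -set_itvcy (@ge0_continuous_FTC2y _ _ F 0 3).
- by rewrite /F/= !mul0r expr0n/= mul0r mulr0 addr0 subr0 Phi0 -EFinB -EFinM;
    congr EFin; field.
- by move=> x _; rewrite mulr_ge0 ?exprn_even_ge0 ?normal_pdf_ge0.
- by apply: continuous_subspaceT; exact: continuous_expr_normal_pdf.
- have -> : (3 : R) = 3 * 1 - (0 + 3 * 0) by ring.
  apply: cvgB; first by apply: cvgM; [exact: cvg_cst|exact: cvg_Phi_y].
  apply: cvgD; first exact: cvg_cube_normal_pdf.
  by apply: cvgM; [exact: cvg_cst|exact: cvg_id_normal_pdf].
- by move=> x _; have [] := dF x.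
- by apply: cvg_at_right_filter; exact: (is_derive_continuous (dF 0)).
- by move=> x _; rewrite derive1E; have [_ ->] := dF x.
Qed.

Lemma continuous_Phi : continuous (@Phi R).
Proof.
by move=> x; exact: is_derive_continuous (is_derive_Phi x).
Qed.

End normal.

Section integral_normal_prob.
Context {R : realType}.
Local Notation mu := (@lebesgue_measure R).
Local Notation phi := (@normal_pdf R 0 1).

(** The change of variables involves the Radon-Nikodym derivative, which agrees almost everywhere
    with [normal_pdf] because both have the same integral over every measurable set. *)
Lemma ge0_integral_normal_prob (m s : R) (f : R -> \bar R) :
  (forall x, 0 <= f x)%E -> measurable_fun setT f ->
  (\int[normal_prob m s]_x f x = \int[mu]_x (f x * (normal_pdf m s x)%:E))%E.
Proof.
move=> f0 mf; have dom := normal_prob_dominates m s.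
rewrite -(Radon_Nikodym_SigmaFinite.change_of_variables dom)//.
have RNi := Radon_Nikodym_SigmaFinite.f_integrable dom.
have mpdf : measurable_fun setT (fun x => (normal_pdf m s x)%:E).
  by apply/measurable_EFinP; exact: measurable_normal_pdf.
apply: ae_eq_integral => //.
- by apply: emeasurable_funM => //; exact: measurable_int RNi.
- exact: emeasurable_funM.
- apply: ae_eqe_mul2l => /=; apply: integral_ae_eq => //=.
  by move=> E _ mE; rewrite -Radon_Nikodym_SigmaFinite.f_integral.
Qed.

(** Reduces expectations under N(m, v) to the standard density, uniformly in [v]: at [v = 0] the law
    is a Dirac mass and both sides equal [f 0]. *)
Lemma ge0_integral_normal_law (d : measure_display) (T : measurableType d)
    (P : probability T R) (Z : T -> R) (m v : R) (f : R -> R) :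
  measurable_fun setT Z -> 0 <= v ->
  (forall B, measurable B -> P [set w | B (Z w)] = normal_law m v B) ->
  continuous f -> (forall x, 0 <= f x) ->
  (\int[P]_w (f (Z w - m))%:E = \int[mu]_x (f (Num.sqrt v * x) * phi x)%:E)%E.
Proof.
move=> mZ v0 ZE cf f0.
have mfm : measurable_fun setT (fun x : R => (f (x - m))%:E).
  apply/measurable_EFinP; apply: measurableT_comp.
    exact: continuous_measurable_fun.
  exact: measurable_funB.
have -> : (\int[P]_w (f (Z w - m))%:E =
           \int[pushforward P (Z : T -> measurableTypeR R)]_x (f (x - m))%:E)%E.
  by rewrite ge0_integral_pushforward// => x _; rewrite lee_fin.
have [v00|vN0] := eqVneq v 0.
  have lawE B : measurable B ->
      pushforward P (Z : T -> measurableTypeR R) B = \d_m B.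
    move=> mB; rewrite -[LHS]/(P [set w | _ (Z w)]) ZE//.
    by rewrite /normal_law v00 eqxx.
  transitivity (\int[\d_(m : measurableTypeR R)]_x (f (x - m))%:E)%E.
    by apply: eq_measure_integral => A mA _; exact: lawE.
  rewrite integral_dirac// diracT mul1e subrr v00 sqrtr0.
  under eq_integral do rewrite mul0r EFinM.
  rewrite ge0_integralZl//.
  - by rewrite integral_normal_pdf mule1.
  - by apply/measurable_EFinP; exact: measurable_normal_pdf.
  - by move=> x _; rewrite lee_fin normal_pdf_ge0.
  - by rewrite lee_fin.
have s0 : 0 < Num.sqrt v by rewrite sqrtr_gt0 lt_neqAle eq_sym vN0.
transitivity (\int[normal_prob m (Num.sqrt v)]_x (f (x - m))%:E)%E.
  apply: eq_measure_integral => A mA _.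
  by rewrite -[LHS]/(P [set w | _ (Z w)]) ZE// /normal_law (negbTE vN0).
rewrite (ge0_integral_normal_prob _ _ _ mfm); last by move=> x; rewrite lee_fin.
under eq_integral do rewrite -EFinM.
rewrite -(integral_normal_pdfM m s0).
- apply: eq_integral => x _; congr ((f _ * _)%:E).
  by rewrite mulrC divfK// gt_eqF.
- move=> x; apply: (@continuous_comp _ _ _ (fun x => Num.sqrt v * x) f).
    by apply: cvgM; [exact: cvg_cst|exact: cvg_id].
  exact: cf.
- by move=> x.
Qed.

End integral_normal_prob.

(** * Means of independent variables *)

Section has_mean.
Context {R : realType} d (T : measurableType d) (P : probability T R).
Implicit Types (f g : T -> R) (r q c : R).

(** Integrability and value are bundled, so that computing a moment also proves that it exists. *)
Definition has_mean f r :=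
  P.-integrable setT (EFin \o f) /\ (\int[P]_w (f w)%:E = r%:E)%E.

Lemma has_mean_measurable f r : has_mean f r -> measurable_fun setT f.
Proof. by move=> [/measurable_int /measurable_EFinP]. Qed.

Lemma eq_has_mean f g r : f =1 g -> has_mean f r -> has_mean g r.
Proof. by move=> /funext ->. Qed.

Lemma has_mean_cst c : has_mean (fun=> c) c.
Proof.
split; first exact: finite_measure_integrable_cst.
by rewrite integral_cst//= probability_setT mule1.
Qed.

Lemma has_meanD f g r q : has_mean f r -> has_mean g q ->
  has_mean (fun w => f w + g w) (r + q).
Proof.
move=> [fi fE] [gi gE]; split; first exact: (integrableD measurableT fi gi).
under eq_integral do rewrite EFinD.
by rewrite integralD// fE gE.
Qed.

Lemma has_meanZ c f r : has_mean f r -> has_mean (fun w => c * f w) (c * r).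
Proof.
move=> [fi fE]; split; first exact: (integrableZl measurableT c fi).
under eq_integral do rewrite EFinM.
by rewrite integralZl// fE.
Qed.

Lemma has_mean_sum (I : Type) (s : seq I) (F : I -> T -> R) (r : I -> R) :
  (forall i, has_mean (F i) (r i)) ->
  has_mean (fun w => \sum_(i <- s) F i w) (\sum_(i <- s) r i).
Proof.
move=> Fr; elim: s => [|i s IH].
  by rewrite big_nil; apply: eq_has_mean (has_mean_cst 0) => w; rewrite big_nil.
rewrite big_cons; apply: eq_has_mean (has_meanD (Fr i) IH) => w.
by rewrite big_cons.
Qed.

Lemma ge0_has_mean f r : measurable_fun setT f -> (forall w, 0 <= f w) ->
  (\int[P]_w (f w)%:E = r%:E)%E -> has_mean f r.
Proof.
move=> mf f0 fE; split => //; apply/integrableP; split.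
  exact/measurable_EFinP.
under eq_integral do rewrite /= ger0_norm//.
by rewrite fE ltry.
Qed.

Lemma le_has_mean f g r : measurable_fun setT g ->
  (forall w, `|g w| <= f w) -> has_mean f r -> exists q, has_mean g q.
Proof.
move=> mg gf [fi fE].
have gi : P.-integrable setT (EFin \o g).
  apply: le_integrable fi => //; first exact/measurable_EFinP.
  by move=> w _; rewrite /= lee_fin (le_trans (gf w))// ler_norm.
exists (fine (\int[P]_w (g w)%:E)); split => //.
by rewrite fineK// integrable_fin_num.
Qed.

Definition independent_rv f g := forall A B, measurable A -> measurable B ->
  P [set w | A (f w) /\ B (g w)] =
  (P [set w | A (f w)] * P [set w | B (g w)])%E.

Lemma independent_rv_comp f g (F G : R -> R) :
  measurable_fun setT F -> measurable_fun setT G ->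
  independent_rv f g -> independent_rv (F \o f) (G \o g).
Proof.
move=> mF mG fg A B mA mB.
have mFA : measurable (F @^-1` A).
  by rewrite -[X in measurable X]setTI; exact: mF.
have mGB : measurable (G @^-1` B).
  by rewrite -[X in measurable X]setTI; exact: mG.
exact: fg mFA mGB.
Qed.

(** Independence says that the joint law and the product of the marginals agree on rectangles, hence
    everywhere; Fubini then factors the integral of the product, Tonelli having given its
    integrability. *)
Lemma has_meanM f g r q : independent_rv f g ->
  has_mean f r -> has_mean g q -> has_mean (fun w => f w * g w) (r * q).
Proof.
move=> fg [fi fE] [gi gE].
have mf : measurable_fun setT f.
  by apply/measurable_EFinP; exact: measurable_int fi.
have mg : measurable_fun setT g.
  by apply/measurable_EFinP; exact: measurable_int gi.
pose X : {RV P >-> R} :=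
  HB.pack f (isMeasurableFun.Build _ _ _ _ f mf).
pose Y : {RV P >-> R} :=
  HB.pack g (isMeasurableFun.Build _ _ _ _ g mg).
pose m1 := distribution P X; pose m2 := distribution P Y.
pose h w : (R * R)%type := (f w, g w).
have mh : measurable_fun setT h by apply/measurable_fun_pairP; split.
have hE D : measurable D -> (m1 \x m2)%E D = pushforward P h D.
  move=> mD; apply: (product_measure_unique _ mD) => A B mA mB.
  exact: fg mA mB.
pose mulE (z : R * R) : \bar R := (z.1 * z.2)%:E.
have mmul : measurable_fun setT (mulE : (R * R)%type -> _).
  by apply/measurable_EFinP; apply: measurable_funM.
have Xi : m1.-integrable setT EFin.
  by apply: integrable_pushforward.
have Yi : m2.-integrable setT EFin.
  by apply: integrable_pushforward.
have intE (k : R) : (\int[m2]_y (k * y)%:E = (k * q)%:E)%E.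
  under eq_integral do rewrite EFinM.
  rewrite integralZl// EFinM -gE; congr (_ * _)%E.
  by rewrite /m2 integral_distribution.
have mabs : measurable_fun setT (fun y : R => `|y%:E|%E).
  exact: measurableT_comp.
have absE (k : R) :
    (\int[m2]_y `|(k * y)%:E| = `|k%:E| * \int[m2]_y `|y%:E|)%E.
  under eq_integral do rewrite EFinM abseM.
  by rewrite ge0_integralZl.
have mulEi : (m1 \x m2)%E.-integrable setT mulE.
  apply/integrable12ltyP => //; rewrite /mulE/=.
  under eq_integral do rewrite absE.
  rewrite /= ge0_integralZr//; last exact: integral_ge0.
  move/integrableP : Xi => [_ Xlty]; move/integrableP : Yi => [_ Ylty].
  by rewrite lte_mul_pinfty// ?integral_ge0// ge0_fin_numE// integral_ge0.
have eqP D : measurable D -> D `<=` setT -> (m1 \x m2)%E D = pushforward P h D.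
  by move=> mD _; exact: hE.
have hi : (pushforward P h).-integrable setT mulE.
  move/integrableP : mulEi => [_ lty]; apply/integrableP; split => //.
  by rewrite -(eq_measure_integral _ eqP).
have mulEhi : P.-integrable setT (mulE \o h).
  have /integrableP[_] := hi.
  rewrite ge0_integral_pushforward//; last exact: measurableT_comp.
  move=> lty; apply/integrableP; split => //.
  by apply/measurable_EFinP; exact: measurable_funM.
split; first exact: mulEhi.
transitivity (\int[pushforward P h]_z mulE z)%E.
  by rewrite (integral_pushforward mh mmul mulEhi).
rewrite -(eq_measure_integral _ eqP).
have <- := integral12_prod_meas1 mulEi; rewrite /fubini_F.
under eq_integral do rewrite intE mulrC EFinM.
rewrite integralZl// mulrC EFinM -fE; congr (_ * _)%E.
by rewrite /m1 integral_distribution.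
Unshelve. exact: mh.
Qed.
End has_mean.

Section independent_family.
Context {R : realType} d (T : measurableType d) (P : probability T R).

Lemma measurable_event (f : T -> R) (A : set R) :
  measurable_fun setT f -> measurable A -> measurable [set w | A (f w)].
Proof. by move=> mf mA; rewrite -[X in measurable X]setTI; exact: mf. Qed.

Lemma measurable_dist_event (f : T -> R) (c eps : R) :
  measurable_fun setT f -> measurable [set w | eps <= `|f w - c|].
Proof.
move=> mf; rewrite (_ : [set w | _] = [set w | `[eps, +oo[%classic `|f w - c|]).
  apply: measurable_event => //.
  by apply: measurableT_comp => //; exact: measurable_funB.
by apply/seteqP; split => w /=; rewrite in_itv/= andbT.
Qed.

(** As functions of [D] both sides are finite measures on the plane; they agree on rectangles, a
    generating family stable under intersection, hence on all measurable sets. *)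
Lemma rectangle_independent (f g : T -> R) (E : set T) :
  measurable_fun setT f -> measurable_fun setT g -> measurable E ->
  (forall A B, measurable A -> measurable B ->
    P ([set w | A (f w) /\ B (g w)] `&` E) =
    (P [set w | A (f w) /\ B (g w)] * P E)%E) ->
  forall D : set (R * R), measurable D ->
    P ([set w | D (f w, g w)] `&` E) = (P [set w | D (f w, g w)] * P E)%E.
Proof.
move=> mf mg mE fgE D mD.
pose h w := (f w, g w).
have mh : measurable_fun setT h by apply/measurable_fun_pairP; split.
pose X : {mfun T >-> (R * R)%type} :=
  HB.pack h (isMeasurableFun.Build _ _ _ _ h mh).
pose PE : {nonneg R} := NngNum (fine_ge0 (measure_ge0 P E)).
have [m1 m1E] : exists m1 : {measure set (R * R) -> \bar R},
    m1 = pushforward (mrestr P mE) h :> (set (R * R) -> \bar R).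
  by unshelve eexists (pushforward (mrestr P mE) h : {measure set _ -> \bar R}).
pose m2 := mscale PE (distribution P X).
have PEE : (PE%:num)%:E = P E by rewrite fineK// fin_num_measure.
pose G : set (set (R * R)) :=
  [set C | exists A, measurable A /\ exists B, measurable B /\ C = A `*` B].
have m2E A : m2 A = (P (h @^-1` A) * P E)%E by rewrite -PEE muleC.
suff : m1 D = m2 D by rewrite m1E m2E.
apply: (measure_unique G (fun=> setT)) => //.
- rewrite measurable_prod_measurableType //; congr (<<s _ >>).
  rewrite predeqE; split => [[A mA [B mB <-]]|[A [mA [B [mB ->]]]]].
    by exists A; split => //; exists B.
  by exists A => //; exists B.
- move=> /= _ _ [X1 [mX1 [X2 [mX2 ->]]]] [Y1 [mY1 [Y2 [mY2 ->]]]].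
  rewrite -setXI; exists (X1 `&` Y1); split; first exact: measurableI.
  by exists (X2 `&` Y2); split => //; exact: measurableI.
- by move=> _; exists setT; split => //; exists setT; split => //;
    rewrite setXTT.
- by apply/seteqP; split => // z _; exists 0%N.
- move=> A [A1 [mA1 [A2 [mA2 ->]]]].
  by rewrite m1E [RHS]m2E; exact: fgE.
- move=> _; rewrite m1E /= /pushforward/= /mrestr.
  by rewrite ltey_eq fin_num_measure// preimage_setT setTI.
Qed.

Variables (I : finType) (xi : I -> T -> R).
Hypothesis mxi : forall i, measurable_fun setT (xi i).

Definition family_event (J : {set I}) (B : I -> set R) : set T :=
  \bigcap_(i in [set i | i \in J]) [set w | B i (xi i w)].

Definition independent_family := forall (J : {set I}) (B : I -> set R),
  (forall i, measurable (B i)) ->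
  P (family_event J B) = (\prod_(i in J) P [set w | B i (xi i w)])%E.

Lemma measurable_family_event J B : (forall i, measurable (B i)) ->
  measurable (family_event J B).
Proof.
move=> mB; apply: fin_bigcap_measurable; first exact: finite_finset.
by move=> i _; exact: measurable_event.
Qed.

Lemma measurable_fun_sum_seq (s : seq I) :
  measurable_fun setT (fun w => \sum_(i <- s) xi i w).
Proof. by apply: measurable_sum. Qed.

(* Peeling off the summand j: on rectangles, the joint law of xi j and of the
   remaining sum is handled by the induction hypothesis, applied to J and to
   J with j added. *)
Lemma sum_independent_event : independent_family ->
  forall (s : seq I) (J : {set I}) B (C : set R), uniq s ->
    (forall i, i \in s -> i \notin J) ->
    (forall i, measurable (B i)) -> measurable C ->
  P ([set w | C (\sum_(i <- s) xi i w)] `&` family_event J B) =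
  (P [set w | C (\sum_(i <- s) xi i w)%R] * P (family_event J B))%E.
Proof.
move=> xiI; elim=> [|j s IH] J B C.
  move=> _ _ mB mC.
  have [C0|C0] := pselect (C 0).
    rewrite (_ : [set w | _] = setT) ?setTI ?probability_setT ?mul1e//.
    by apply/seteqP; split => // w _ /=; rewrite big_nil.
  rewrite (_ : [set w | _] = set0) ?set0I ?measure0 ?mul0e//.
  by apply/seteqP; split => // w /=; rewrite big_nil.
move=> /andP[js us] sJ mB mC.
have jJ : j \notin J by apply: sJ; rewrite mem_head.
have mS := measurable_fun_sum_seq s.
pose D : set (R * R) := [set z | C (z.1 + z.2)].
have mD : measurable D.
  have mp : measurable_fun setT (fun z : R * R => z.1 + z.2).
    by apply: measurable_funD.
  by rewrite /D -[X in measurable X]setTI; exact: mp.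
have eqD : [set w | C (\sum_(i <- j :: s) xi i w)] =
    [set w | D (xi j w, \sum_(i <- s) xi i w)].
  by apply/seteqP; split => w /=; rewrite /D/= big_cons.
rewrite eqD; apply: (rectangle_independent (mxi j) mS) mD.
  exact: measurable_family_event.
move=> A A' mA mA'.
(* [BA] records the event on [xi j] as one more constraint of the family; those on [J] are unchanged
   since [j] is outside [J]. *)
pose BA i := if i == j then A else B i.
have mBA i : measurable (BA i) by rewrite /BA; case: ifP.
have ejJ : family_event (j |: J) BA = [set w | A (xi j w)] `&` family_event J B.
  apply/seteqP; split => w.
    move=> h; split.
      by have := h j; rewrite /BA/= eqxx; apply; rewrite setU11.
    move=> i /= iJ; have := h i; rewrite /BA/=; case: eqP => [ij|_].
      by move: jJ; rewrite -ij iJ.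
    by apply; rewrite !inE iJ orbT.
  move=> [Aw h] i /=; rewrite /BA !inE; case: eqP => [->//|_] /= iJ.
  exact: h.
have ej : family_event [set j] BA = [set w | A (xi j w)].
  apply/seteqP; split => w.
    by move=> h; have := h j; rewrite /BA/= eqxx; apply; rewrite set11.
  by move=> Aw i /=; rewrite /BA !inE => /eqP ->; rewrite eqxx.
have e1 : [set w | A (xi j w) /\ A' (\sum_(i <- s) xi i w)] =
    [set w | A' (\sum_(i <- s) xi i w)] `&` family_event [set j] BA.
  by rewrite ej; apply/seteqP; split => w [].
have e2 : [set w | A (xi j w) /\ A' (\sum_(i <- s) xi i w)] `&`
      family_event J B =
    [set w | A' (\sum_(i <- s) xi i w)] `&` family_event (j |: J) BA.
  rewrite ejJ setIA; congr (_ `&` _).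
  by apply/seteqP; split => w [].
have sj i : i \in s -> i != j by apply: contraTneq => ->.
rewrite e2 e1 IH//; last first.
  by move=> i si; rewrite !inE negb_or sj//= sJ// inE si orbT.
rewrite IH//; last by move=> i si; rewrite inE sj.
rewrite -muleA; congr (_ * _)%E.
rewrite !xiI// big_setU1//= big_set1; congr (_ * _)%E.
apply: eq_bigr => i iJ; rewrite /BA; case: eqP => // ij.
by move: jJ; rewrite -ij iJ.
Qed.

Lemma sum_independent_rv (s : seq I) (j : I) : independent_family ->
  uniq (j :: s) -> independent_rv P (xi j) (fun w => \sum_(i <- s) xi i w).
Proof.
move=> xiI /andP[js us] A B mA mB.
have ej : family_event [set j] (fun=> A) = [set w | A (xi j w)].
  apply/seteqP; split => w.
    by move=> h; have := h j; apply; rewrite /= set11.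
  by move=> Aw i /=; rewrite !inE => /eqP ->.
have := @sum_independent_event xiI s [set j] (fun=> A) B us.
rewrite ej muleC => <-//.
  by congr (P _); apply/seteqP; split => w [].
by move=> i si; rewrite inE; apply: contraNneq js => <-.
Qed.

End independent_family.

(** * Sums of independent normal vectors *)

Section gaussian_moments.
Context {R : realType} d (T : measurableType d) (P : probability T R).
Implicit Types (f g : T -> R).

(** These are the first four moments of N(0, v), a property that is stable under independent sums
    and strong enough for the variance of a quadratic form. *)
Definition gaussian_moments f (v : R) :=
  [/\ has_mean P f 0, has_mean P (fun w => f w ^+ 2) v,
      has_mean P (fun w => f w ^+ 3) 0 &
      has_mean P (fun w => f w ^+ 4) (3 * v ^+ 2)].

(** In the binomial expansions every term with an odd power has mean 0; for the fourth moment
    [3 u^2 + 6 u v + 3 v^2 = 3 (u + v)^2] remains. *)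
Lemma gaussian_momentsD f g u v : independent_rv P f g ->
  gaussian_moments f u -> gaussian_moments g v ->
  gaussian_moments (fun w => f w + g w) (u + v).
Proof.
move=> fg [f1 f2 f3 f4] [g1 g2 g3 g4].
have fgX m n : independent_rv P (fun w => f w ^+ m) (fun w => g w ^+ n).
  exact: (@independent_rv_comp _ _ _ _ f g (fun x => x ^+ m) (fun x => x ^+ n)
    (measurable_funX _ (@measurable_id _ _ _))
    (measurable_funX _ (@measurable_id _ _ _))).
split.
- by have := has_meanD f1 g1; rewrite addr0.
- have f1g1 := has_meanM fg f1 g1.
  have := has_meanD (has_meanD f2 (has_meanZ 2 f1g1)) g2.
  rewrite (_ : u + _ + v = u + v); last by ring.
  by apply: eq_has_mean => w; ring.
- have f2g1 := has_meanM (fgX 2%N 1%N) f2 g1.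
  have f1g2 := has_meanM (fgX 1%N 2%N) f1 g2.
  have := has_meanD (has_meanD f3 (has_meanZ 3 f2g1))
    (has_meanD (has_meanZ 3 f1g2) g3).
  rewrite (_ : _ + _ = 0); last by ring.
  by apply: eq_has_mean => w; ring.
- have f3g1 := has_meanM (fgX 3%N 1%N) f3 g1.
  have f2g2 := has_meanM (fgX 2%N 2%N) f2 g2.
  have f1g3 := has_meanM (fgX 1%N 3%N) f1 g3.
  have := has_meanD (has_meanD (has_meanD f4 (has_meanZ 4 f3g1))
    (has_meanZ 6 f2g2))
    (has_meanD (has_meanZ 4 f1g3) g4).
  rewrite (_ : _ + _ = 3 * (u + v) ^+ 2); last by ring.
  by apply: eq_has_mean => w; ring.
Qed.

Lemma gaussian_moments0 : gaussian_moments (fun=> 0) 0.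
Proof.
have h := has_mean_cst P 0; split => //.
- by apply: eq_has_mean h => w; rewrite expr0n.
- by apply: eq_has_mean h => w; rewrite expr0n.
- rewrite (_ : 3 * 0 ^+ 2 = 0); last by ring.
  by apply: eq_has_mean h => w; rewrite expr0n.
Qed.

Lemma gaussian_moments_sum (I : finType) (xi : I -> T -> R) (v : I -> R) :
  independent_family P xi -> (forall i, gaussian_moments (xi i) (v i)) ->
  gaussian_moments (fun w => \sum_i xi i w) (\sum_i v i).
Proof.
move=> xiI xiv.
have mxi i : measurable_fun setT (xi i).
  by have [/has_mean_measurable] := xiv i.
have := index_enum_uniq I; elim: (index_enum I) => [_|j s IH js].
  rewrite big_nil; under eq_fun do rewrite big_nil.
  exact: gaussian_moments0.
rewrite big_cons; under eq_fun do rewrite big_cons.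
apply: gaussian_momentsD; [exact: sum_independent_rv js|exact: xiv|].
by apply: IH; case/andP: js.
Qed.

(** Even moments are read off the standard density, odd ones come from symmetry. The law of [- Z] is
    a hypothesis because, for a linear form of a normal vector, it is the defining property at
    [- a]. *)
Lemma gaussian_moments_normal_law (Z : T -> R) (m v : R) :
  measurable_fun setT Z -> 0 <= v ->
  (forall B, measurable B -> P [set w | B (Z w)] = normal_law m v B) ->
  (forall B, measurable B -> P [set w | B (- Z w)] = normal_law (- m) v B) ->
  gaussian_moments (fun w => Z w - m) v.
Proof.
move=> mZ v0 Zlaw NZlaw.
have mW : measurable_fun setT (fun w => Z w - m) by exact: measurable_funB.
have mNZ : measurable_fun setT (fun w => - Z w) by exact: measurableT_comp.
have even k c : ~~ odd k ->
    (\int[lebesgue_measure]_x (x ^+ k * normal_pdf (0 : R) 1 x)%:E = c%:E)%E ->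
    has_mean P (fun w => (Z w - m) ^+ k) (Num.sqrt v ^+ k * c).
  move=> ek kc.
  have xk0 (x : R) : 0 <= x ^+ k by rewrite exprn_even_ge0.
  apply: ge0_has_mean => //; first exact: measurable_funX.
  rewrite (ge0_integral_normal_law mZ v0 Zlaw (@exprn_continuous R k) xk0).
  under eq_integral do rewrite exprMn -mulrA EFinM.
  rewrite ge0_integralZl ?kc//.
  - apply/measurable_EFinP; apply: measurable_funM;
      last exact: measurable_normal_pdf.
    exact: exprn_measurable.
  - by move=> x _; rewrite lee_fin mulr_ge0// normal_pdf_ge0.
have W2 : has_mean P (fun w => (Z w - m) ^+ 2) v.
  by have := even 2%N 1 isT integral_sqr_normal_pdf; rewrite mulr1 sqr_sqrtr.
have W4 : has_mean P (fun w => (Z w - m) ^+ 4) (3 * v ^+ 2).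
  have := even 4%N 3 isT integral_exp4_normal_pdf.
  by rewrite (exprM _ 2 2) sqr_sqrtr// mulrC.
(* W = Z - m and - W have the same law, so their positive parts have the same
   odd moments. *)
have oddk k : odd k -> (k <= 4)%N -> has_mean P (fun w => (Z w - m) ^+ k) 0.
  move=> ok k4.
  pose pos (x : R) : R := Num.max x 0 ^+ k.
  have cpos : continuous pos.
    move=> x; apply: (cvg_comp (idfun \max cst (0 : R)) (fun y : R => y ^+ k)).
      by apply: (@continuous_max R R idfun (cst 0));
        [exact: cvg_id|exact: cvg_cst].
    exact: exprn_continuous.
  have pos0 x : 0 <= pos x by rewrite exprn_ge0// le_max lexx orbT.
  (* The bound uses [k <= 4] beyond 1; integrability thus follows from the fourth moment. *)
  have posB x : pos x <= 1 + x ^+ 4.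
    rewrite /pos; have [x0|x0] := leP x 0.
      by rewrite expr0n (gtn_eqF (odd_gt0 ok)) addr_ge0// exprn_even_ge0.
    have [x1|/ltW x1] := leP x 1.
      apply: le_trans (_ : 1 <= _); first by rewrite exprn_ile1// ltW.
      by rewrite lerDl exprn_even_ge0.
    apply: le_trans (_ : x ^+ 4 <= _); first by rewrite ler_weXn2l.
    by rewrite lerDr.
  have mpos : measurable_fun setT pos by exact: continuous_measurable_fun.
  have hpos (V : T -> R) : measurable_fun setT V ->
      (forall w, V w ^+ 4 = (Z w - m) ^+ 4) ->
      exists q, has_mean P (fun w => pos (V w)) q.
    move=> mV VW; apply: le_has_mean (has_meanD (has_mean_cst P 1) W4).
      exact: measurableT_comp.
    by move=> w; rewrite ger0_norm// -VW.
  have [q Wq] := hpos _ mW (fun=> erefl).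
  have [q' Wq'] : exists q, has_mean P (fun w => pos (- Z w - - m)) q.
    by apply: hpos; [exact: measurable_funB|move=> w; ring].
  have qq' : q = q'.
    have [_] := Wq; have [_] := Wq'.
    rewrite (ge0_integral_normal_law mZ v0 Zlaw cpos pos0).
    by rewrite (ge0_integral_normal_law mNZ v0 NZlaw cpos pos0) => -> -[].
  (* For odd [k], [x ^+ k = pos x - pos (- x)]. *)
  have := has_meanD Wq (has_meanZ (- 1) Wq'); rewrite qq' mulN1r subrr.
  apply: eq_has_mean => w; rewrite mulN1r -opprD.
  rewrite /pos; move: (Z w - m) => x.
  have k0 : k != 0%N by rewrite -lt0n odd_gt0.
  have [x0|x0] := leP x 0.
    rewrite max_l ?oppr_ge0// expr0n (negbTE k0) sub0r exprNn -signr_odd.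
    by rewrite ok expr1 mulN1r opprK.
  by rewrite max_r ?oppr_le0 ?ltW// expr0n (negbTE k0) subr0.
split => //; first by have := oddk 1%N isT isT.
exact: oddk.
Qed.

(** The space [U] is free because the fact serves twice: on the probability space, and on the
    sigma-algebra generated by the coordinates of a single vector. *)
Lemma measurable_linear_form dU (U : measurableType dU) p (a mu : 'cV[R]_p)
    (X : U -> 'cV[R]_p) :
  (forall i, measurable_fun setT (fun w => X w i 0)) ->
  measurable_fun setT (fun w => (a^T *m (X w - mu)) 0 0).
Proof.
move=> mX; under eq_fun do rewrite mxE.
apply: measurable_sum => i; under eq_fun do rewrite !mxE.
by apply: measurable_funM => //; exact: measurable_funB.
Qed.

Lemma gaussian_moments_normal_vector p (X : T -> 'cV[R]_p) mu S a :
  normal_vector P X mu S -> 0 <= bilin a S a ->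
  gaussian_moments (fun w => (a^T *m (X w - mu)) 0 0) (bilin a S a).
Proof.
move=> [mX Xlaw] S0.
have subE (A B : 'M[R]_1) : (A - B) 0 0 = A 0 0 - B 0 0.
  by rewrite [LHS]mxE [X in _ + X]mxE.
have oppE (A : 'M[R]_1) : (- A) 0 0 = - A 0 0 by rewrite [LHS]mxE.
under eq_fun do rewrite mulmxBr subE.
apply: gaussian_moments_normal_law => //.
- have := @measurable_linear_form _ _ _ a 0 X mX.
  by under eq_fun do rewrite subr0.
- exact: Xlaw.
- move=> B mB; have := Xlaw (- a) B mB.
  rewrite bilinNl bilinNr opprK linearN/= mulNmx oppE => <-.
  by congr (P _); apply/seteqP; split => w /=; rewrite mulNmx oppE.
Qed.

(** A linear form is measurable for the sigma-algebra generated by the coordinates, so its events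
    are among those that [independent_vectors] controls. *)
Lemma independent_linear_forms p (I : finType) (X : I -> T -> 'cV[R]_p)
    (mu a : I -> 'cV[R]_p) :
  (forall i k, measurable_fun setT (fun w => X i w k 0)) ->
  independent_vectors P X ->
  independent_family P (fun i w => ((a i)^T *m (X i w - mu i)) 0 0).
Proof.
move=> mX XI J B mB; apply: XI => i _.
pose G := \big[setU/set0]_(k < p) preimage_set_system setT
  (fun w : T => X i w k 0) measurable.
have mXG k : measurable_fun setT (fun w : g_sigma_algebraType G => X i w k 0).
  move=> _ A mA; rewrite setTI; apply: sub_sigma_algebra.
  rewrite /G -bigcup_seq; exists k; first by rewrite /= mem_index_enum.
  by exists A => //; rewrite setTI.
have := @measurable_linear_form _ (g_sigma_algebraType G) p
  (a i) (mu i) (X i) mXG.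
by move=> /(_ measurableT (B i) (mB i)); rewrite setTI.
Qed.

End gaussian_moments.

Section quadratic_form.
Context {R : realType} d (T : measurableType d) (P : probability T R).

Lemma chebyshev_has_mean (f : T -> R) (c q eps : R) : 0 < eps ->
  measurable_fun setT f -> has_mean P (fun w => (f w - c) ^+ 2) q ->
  (P [set w | (eps <= `|f w - c|)%R] <= (q / eps ^+ 2)%:E)%E.
Proof.
move=> e0 mf [_ fq]; set E := [set w | _].
have mfc : measurable_fun setT (fun w => (f w - c) ^+ 2).
  by apply: measurable_funX; exact: measurable_funB.
have mE : measurable E by exact: measurable_dist_event.
suff : ((eps ^+ 2)%:E * P E <= q%:E)%E.
  rewrite -[P E]fineK ?fin_num_measure// -EFinM !lee_fin.
  by rewrite ler_pdivlMr ?exprn_gt0// mulrC.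
rewrite -fq -integral_cst//.
apply: (@le_trans _ _ (\int[P]_(w in E) ((f w - c) ^+ 2)%:E)%E).
  apply: ge0_le_integral => //.
  - by move=> w _; rewrite lee_fin sqr_ge0.
  - by apply/measurable_EFinP; exact: measurable_funTS.
  - by move=> w Ew; rewrite lee_fin -[leRHS]real_normK ?num_real//
      lerXn2r ?nnegrE// ltW.
apply: ge0_subset_integral => //; first exact/measurable_EFinP.
by move=> w _; rewrite lee_fin sqr_ge0.
Qed.

(* Polarisation of fourth powers gives E[zi^2 zj^2] = s^2 without using the
   independence of zi and zj. *)
Lemma has_mean_sqr_sqr (f g : T -> R) (s : R) :
  gaussian_moments P f s -> gaussian_moments P g s ->
  gaussian_moments P (fun w => f w + g w) (2 * s) ->
  gaussian_moments P (fun w => f w - g w) (2 * s) ->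
  has_mean P (fun w => f w ^+ 2 * g w ^+ 2) (s ^+ 2).
Proof.
move=> [_ _ _ f4] [_ _ _ g4] [_ _ _ p4] [_ _ _ m4].
(* [12 f^2 g^2 = (f + g)^4 + (f - g)^4 - 2 (f^4 + g^4)], with mean [24 s^2 - 12 s^2]. *)
have := has_meanZ 12^-1 (has_meanD (has_meanD p4 m4)
  (has_meanZ (- 2) (has_meanD f4 g4))).
rewrite (_ : 12^-1 * _ = s ^+ 2); last by field.
by apply: eq_has_mean => w; field.
Qed.

(** The mean of the squared sum is [p^2 s^2 + 2 p s^2]: each pair contributes [s^2], and each of the
    [p] diagonal pairs [2 s^2] more, its mean being [3 s^2]. Centring removes [p^2 s^2]. *)
Lemma has_mean_sum_sqr p (z : 'I_p -> T -> R) (s : R) :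
  (forall i, gaussian_moments P (z i) s) ->
  (forall i j, i != j -> gaussian_moments P (fun w => z i w + z j w) (2 * s)) ->
  (forall i j, i != j -> gaussian_moments P (fun w => z i w - z j w) (2 * s)) ->
  has_mean P (fun w => (\sum_i z i w ^+ 2 - s * p%:R) ^+ 2) (2 * p%:R * s ^+ 2).
Proof.
move=> z1 zp zm.
have zz i j : has_mean P (fun w => z i w ^+ 2 * z j w ^+ 2)
    (s ^+ 2 + (i == j)%:R * (2 * s ^+ 2)).
  have [->|ij] := eqVneq i j.
    have [_ _ _ z4] := z1 j.
    rewrite (_ : _ + _ = 3 * s ^+ 2); last by rewrite /= mulr1n; ring.
    by apply: eq_has_mean z4 => w; ring.
  by rewrite /= mulr0n mul0r addr0; apply: has_mean_sqr_sqr => //;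
    [exact: zp|exact: zm].
have z2 i : has_mean P (fun w => z i w ^+ 2) s by have [] := z1 i.
have h1 := has_mean_sum (index_enum 'I_p)
  (fun i => has_mean_sum (index_enum 'I_p) (zz i)).
have h2 := has_meanZ (- 2 * (s * p%:R)) (has_mean_sum (index_enum 'I_p) z2).
have h := has_meanD (has_meanD h1 h2) (has_mean_cst P ((s * p%:R) ^+ 2)).
have -> : 2 * p%:R * s ^+ 2 =
    \sum_(i < p) \sum_(j < p) (s ^+ 2 + (i == j)%:R * (2 * s ^+ 2)) +
    - 2 * (s * p%:R) * (\sum_(i < p) s) + (s * p%:R) ^+ 2.
  transitivity (\sum_(i < p) (p%:R * s ^+ 2 + 2 * s ^+ 2) +
      - 2 * (s * p%:R) * (\sum_(i < p) s) + (s * p%:R) ^+ 2).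
    rewrite !sumr_const card_ord -[in _ * (s *+ p)]mulr_natl.
    by rewrite -[(_ + _) *+ p]mulr_natl; ring.
  congr (_ + _ + _); apply: eq_bigr => i _.
  rewrite big_split/= sumr_const card_ord.
  congr (_ + _); first by rewrite mulr_natl.
  rewrite (bigD1 i)//= eqxx mul1r big1 ?addr0// => j ji.
  by rewrite eq_sym (negbTE ji) mul0r.
apply: eq_has_mean h => w.
rewrite [in RHS]sqrrB [X in _ = X - _ + _]expr2 big_distrlr/=
  -[in RHS]mulr_natl.
by congr (_ + _); ring.
Qed.

Variables (p : nat) (S : 'M[R]_p) (I : finType) (X : I -> T -> 'cV[R]_p).
Variables (mu : I -> 'cV[R]_p) (c : I -> R).
Hypotheses (Scov : covariance_matrix S) (Sunit : S \in unitmx).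
Hypothesis Xnormal : forall i, normal_vector P (X i) (mu i) S.
Hypothesis Xindep : independent_vectors P X.

(** Weights and centres depend on the index so that a single sum runs over both samples. *)
Definition centered_sum (w : T) : 'cV[R]_p := \sum_i c i *: (X i w - mu i).

Lemma gaussian_moments_centered_sum (a : 'cV[R]_p) :
  gaussian_moments P (fun w => (a^T *m centered_sum w) 0 0)
    ((\sum_i c i ^+ 2) * bilin a S a).
Proof.
have XE w : (a^T *m centered_sum w) 0 0 =
    \sum_i ((c i *: a)^T *m (X i w - mu i)) 0 0.
  rewrite /centered_sum mulmx_sumr summxE; apply: eq_bigr => i _.
  by rewrite [(c i *: a)^T]linearZ/= -scalemxAl -scalemxAr.
under eq_fun do rewrite XE.
rewrite mulr_suml; apply: gaussian_moments_sum.
  by apply: independent_linear_forms => // i k; have [] := Xnormal i.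
move=> i; have := gaussian_moments_normal_vector (a := c i *: a) (Xnormal i).
rewrite bilinZl bilinZr mulrA -expr2; apply.
by rewrite mulr_ge0 ?sqr_ge0//; exact: Scov.2.
Qed.

(** The rows [a i] of a whitening matrix are orthonormal for [S]: the coordinates of [A e] have
    variance [s], and their pairwise sums and differences, the linear forms of [a i + a j] and
    [a i - a j], have variance [2 s]. *)
Lemma has_mean_quadratic_form :
  has_mean P (fun w => (bilin (centered_sum w) (invmx S) (centered_sum w) -
                        (\sum_i c i ^+ 2) * p%:R) ^+ 2)
             (2 * p%:R * (\sum_i c i ^+ 2) ^+ 2).
Proof.
have [A [ASA iS]] := covariance_whitening Scov Sunit.
pose a i : 'cV[R]_p := (row i A)^T.
have aSa i j : bilin (a i) S (a j) = (i == j)%:R.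
  rewrite /bilin /a trmxK -row_mul.
  rewrite (_ : _ 0 0 = (A *m S *m A^T) i j); first by rewrite ASA mxE.
  by rewrite !mxE; apply: eq_bigr => k _; rewrite !mxE.
set s := \sum_i _.
have aE i (v : 'cV[R]_p) : ((a i)^T *m v) 0 0 = (A *m v) i 0.
  by rewrite /a trmxK -row_mul mxE.
have aDE i j (v : 'cV[R]_p) :
    ((a i + a j)^T *m v) 0 0 = (A *m v) i 0 + (A *m v) j 0.
  by rewrite linearD/= mulmxDl mxE !aE.
have aBE i j (v : 'cV[R]_p) :
    ((a i - a j)^T *m v) 0 0 = (A *m v) i 0 - (A *m v) j 0.
  by rewrite linearB/= mulmxBl mxE [X in _ + X]mxE !aE.
have z1 i : gaussian_moments P (fun w => (A *m centered_sum w) i 0) s.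
  have := gaussian_moments_centered_sum (a i).
  by rewrite aSa eqxx mulr1; under eq_fun do rewrite aE.
have qE w : bilin (centered_sum w) (invmx S) (centered_sum w) =
    \sum_i (A *m centered_sum w) i 0 ^+ 2.
  rewrite iS -(mulmx1 A^T) -bilin_mulmx bilin1.
  by apply: eq_bigr => i _; rewrite expr2.
under eq_fun do rewrite qE.
apply: has_mean_sum_sqr => // i j ij.
- have := gaussian_moments_centered_sum (a i + a j).
  rewrite bilinDl !bilinDr !aSa !eqxx (eq_sym j) (negbTE ij) /= addr0 add0r.
  rewrite (_ : _ * (1%:R + 1%:R) = 2 * s); last by rewrite /s; ring.
  by under eq_fun do rewrite aDE.
- have := gaussian_moments_centered_sum (a i - a j).
  rewrite bilinDl !bilinDr !bilinNl !bilinNr !aSa !eqxx.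
  rewrite (eq_sym j) (negbTE ij) /= oppr0 addr0 add0r opprK.
  rewrite (_ : _ * (1%:R + 1%:R) = 2 * s); last by rewrite /s; ring.
  by under eq_fun do rewrite aBE.
Qed.

End quadratic_form.

(** * The misclassification rate *)

Section misclassification_rate.
Context {R : realType} d (T : measurableType d) (Q : probability T R).

(** With [a = S^-1 (x1 - x2)] the score is the linear form of [a] up to a constant, hence univariate
    normal with variance [a^T S a = (x1 - x2)^T S^-1 (x1 - x2)]. *)
Lemma lda1_rateE p (Y1 Y2 : T -> 'cV[R]_p) mu1 mu2 S x1 x2 :
  covariance_matrix S -> S \in unitmx ->
  normal_vector Q Y1 mu1 S -> normal_vector Q Y2 mu2 S ->
  lda1_rate Q Y1 Y2 S x1 x2 = lda1_formula mu1 mu2 S x1 x2.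
Proof.
move=> Scov Su [_ Y1law] [_ Y2law].
have [ST S_ge0] := Scov.
have iST : (invmx S)^T = invmx S by rewrite trmx_inv ST.
rewrite /lda1_rate /lda1_formula /lda1_class1.
set D := x1 - x2; set c := 2^-1 *: (x1 + x2).
pose a := invmx S *m D.
pose l (x : 'cV[R]_p) := (a^T *m x) 0 0.
have lE x : bilin (x - c) (invmx S) D = l x - l c.
  rewrite (bilinC _ _ iST) bilinDr bilinNr.
  by rewrite /l /bilin /a trmx_mul iST.
have aSa : bilin a S a = bilin D (invmx S) D.
  by rewrite /a bilin_mulmx iST mulVmx// mul1mx.
have v_ge0 : 0 <= bilin D (invmx S) D by rewrite -aSa.
rewrite !lE.
under [X in fine (Q X)]eq_set do rewrite lE.
under [X in _ + _ * fine (Q X)]eq_set do rewrite lE.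
(* If [x1 = x2], every observation goes to class 2, so the rate is 1/2; in the formula the division
   by 0 yields 0, and [Phi 0 = 1/2]. *)
have [v0|vN0] := eqVneq (bilin D (invmx S) D) 0.
  have a0 : a = 0.
    apply/eqP/negPn/negP => aN0.
    have [_ /(_ a aN0)] := covariance_matrix_posdef Scov Su.
    by rewrite aSa v0 ltxx.
  have l0 x : l x = 0 by rewrite /l a0 trmx0 mul0mx mxE.
  under [X in fine (Q X)]eq_set do rewrite !l0 subrr ltxx.
  under [X in _ + _ * fine (Q X)]eq_set do rewrite !l0 subrr ltxx.
  rewrite v0 sqrtr0 invr0 !mulr0 Phi0.
  rewrite (_ : [set w | ~~ false] = setT); last by apply/seteqP; split.
  rewrite (_ : [set w | false] = set0); last by apply/seteqP; split.
  by rewrite probability_setT measure0/=; lra.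
have s0 : 0 < Num.sqrt (bilin D (invmx S) D).
  by rewrite sqrtr_gt0 lt_neqAle eq_sym vN0.
have P1 : Q [set w | ~~ (0 < l (Y1 w) - l c)] =
    (Phi ((-1) ^+ 1 * (l mu1 - l c) / Num.sqrt (bilin D (invmx S) D)))%:E.
  rewrite (_ : [set w | _] = [set w | `]-oo, l c]%classic (l (Y1 w))]).
    rewrite Y1law// /normal_law aSa (negbTE vN0) fine_normal_prob_ray//.
    by rewrite expr1 mulN1r opprB.
  by apply/seteqP; split => w /=; rewrite in_itv/= -leNgt subr_le0.
(* Reading the law along [- a] turns the upper ray into a lower one; its endpoint has no mass. *)
have P2 : Q [set w | 0 < l (Y2 w) - l c] =
    (Phi ((-1) ^+ 2 * (l mu2 - l c) / Num.sqrt (bilin D (invmx S) D)))%:E.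
  have lN x : ((- a)^T *m x) 0 0 = - l x by rewrite linearN/= mulNmx [LHS]mxE.
  rewrite (_ : [set w | _] =
    [set w | `]-oo, - l c[%classic (((- a)^T *m (Y2 w)) 0 0)]).
    rewrite Y2law// /normal_law bilinNl bilinNr opprK aSa (negbTE vN0).
    rewrite normal_prob_open_ray fine_normal_prob_ray// lN.
    by rewrite sqrrN expr1n mul1r opprK addrC.
  by apply/seteqP; split => w /=; rewrite in_itv/= lN ltrN2 subr_gt0.
by rewrite P1 P2 [RHS]mulrDr.
Qed.

End misclassification_rate.

(** * Convergence in probability *)

(** Since the inverse of 0 is 0, the function is discontinuous at 0; it is measurable as a real
    power of the square root. *)
Lemma measurable_inv_sqrt (R : realType) :
  measurable_fun setT (fun x : R => (Num.sqrt x)^-1).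
Proof.
under eq_fun do rewrite -powR_inv1 ?sqrtr_ge0//.
apply: (measurableT_comp (measurable_powR (- 1))).
by apply: continuous_measurable_fun; exact: sqrt_continuous.
Qed.

Section convergence_in_probability.
Context {R : realType} (d : nat -> measure_display).
Context (T : forall m, measurableType (d m)).
Context (P : forall m, probability (T m) R).
Implicit Types Z : forall m, T m -> R.

Lemma eq_cvg_in_probability Z1 Z2 c1 c2 : c1 = c2 ->
  (forall m w, Z1 m w = Z2 m w) ->
  cvg_in_probability P Z1 c1 -> cvg_in_probability P Z2 c2.
Proof.
move=> -> Z12; suff -> : Z1 = Z2 by [].
by apply: functional_extensionality_dep => m; exact/funext/Z12.
Qed.

(** Continuous mapping, with continuity only at the limit point: this admits division by a square
    root that may vanish elsewhere. A deviation of [g] forces a deviation of one argument, and a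
    union bound concludes. *)
Lemma cvg_in_probability_map2 Z1 Z2 (c1 c2 : R) (g : R * R -> R) :
  measurable_fun setT g -> {for (c1, c2), continuous g} ->
  cvg_in_probability P Z1 c1 -> cvg_in_probability P Z2 c2 ->
  cvg_in_probability P (fun m w => g (Z1 m w, Z2 m w)) (g (c1, c2)).
Proof.
move=> mg cg [mZ1 Z1c] [mZ2 Z2c].
have mgZ m : measurable_fun setT (fun w => g (Z1 m w, Z2 m w)).
  by apply: measurableT_comp => //; apply/measurable_fun_pairP; split.
split => // eps e0.
have [del del0 gdel] : exists2 del : R, 0 < del & forall x y,
    `|x - c1| < del -> `|y - c2| < del -> `|g (x, y) - g (c1, c2)| < eps.
  move/cvgrPdist_lt : cg => /(_ _ e0) /nbhs_ballP[del /= del0 h].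
  exists del => // x y xd yd; rewrite distrC; apply: (h (x, y)).
  by split; rewrite /ball/= distrC.
apply: (squeeze_cvge (f := fun=> 0%E)
  (h := fun m => (P m [set w | (del <= `|Z1 m w - c1|)%R] +
             P m [set w | (del <= `|Z2 m w - c2|)%R])%E)).
- apply: nearW => m; rewrite measure_ge0/=.
  apply: le_trans (measureU2 _ _ _); [|exact: measurable_dist_event..].
  apply: le_measure; rewrite ?inE; [exact: measurable_dist_event| |].
    by apply: measurableU; exact: measurable_dist_event.
  move=> w /= ew; have [|w1] := leP del `|Z1 m w - c1|; first by left.
  have [|w2] := leP del `|Z2 m w - c2|; first by right.
  by have := lt_le_trans (gdel _ _ w1 w2) ew; rewrite ltxx.
- exact: cvg_cst.
- by rewrite -[0%E]adde0; apply: cvgeD => //; [exact: Z1c|exact: Z2c].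
Qed.

Lemma cvg_in_probability_cst c : cvg_in_probability P (fun m _ => c) c.
Proof.
split => // eps e0; rewrite (_ : (fun m => _) = fun=> 0%E);
  first exact: cvg_cst.
apply/funext => m; rewrite (_ : [set w | _] = set0) ?measure0//.
by apply/seteqP; split => // w /=; rewrite subrr normr0 leNgt e0.
Qed.

Lemma cvg_in_probabilityD Z1 Z2 c1 c2 :
  cvg_in_probability P Z1 c1 -> cvg_in_probability P Z2 c2 ->
  cvg_in_probability P (fun m w => Z1 m w + Z2 m w) (c1 + c2).
Proof.
apply: (@cvg_in_probability_map2 _ _ c1 c2 (fun z => z.1 + z.2)).
  exact: measurable_funD.
by apply: cvgD; [exact: cvg_fst|exact: cvg_snd].
Qed.

Lemma cvg_in_probabilityZ Z a c : cvg_in_probability P Z c ->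
  cvg_in_probability P (fun m w => a * Z m w) (a * c).
Proof.
apply: (@cvg_in_probability_map2 _ _ a c (fun z => z.1 * z.2)) => //.
- exact: measurable_funM.
- by apply: cvgM; [exact: cvg_fst|exact: cvg_snd].
- exact: cvg_in_probability_cst.
Qed.

Lemma cvg_in_probability_Phi Z V c v : 0 < v ->
  cvg_in_probability P Z c -> cvg_in_probability P V v ->
  cvg_in_probability P (fun m w => Phi (Z m w / Num.sqrt (V m w)))
    (Phi (c / Num.sqrt v)).
Proof.
move=> v0.
apply: (@cvg_in_probability_map2 _ _ c v (fun z => Phi (z.1 / Num.sqrt z.2))).
  apply: measurableT_comp.
    by apply: continuous_measurable_fun; exact: continuous_Phi.
  apply: measurable_funM => //.
  exact: (measurableT_comp (@measurable_inv_sqrt R)).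
apply: (cvg_comp (fun z : R * R => z.1 / Num.sqrt z.2) (@Phi R)); last first.
  exact: continuous_Phi.
apply: cvgM; first exact: cvg_fst.
apply: cvgV; first by rewrite gt_eqF// sqrtr_gt0.
apply: (cvg_comp snd (@Num.sqrt R)); first exact: cvg_snd.
exact: sqrt_continuous.
Qed.

(** Half of [eps] absorbs the drift of the centres [c m] towards [l], the other half goes to
    Chebyshev. The moments are asked only eventually, because the samples may be empty for small
    [m]. *)
Lemma cvg_in_probability_L2 Z (c q : nat -> R) l :
  (forall m, measurable_fun setT (Z m)) ->
  (\forall m \near \oo, has_mean (P m) (fun w => (Z m w - c m) ^+ 2) (q m)) ->
  c @ \oo --> l -> q @ \oo --> (0 : R) ->
  cvg_in_probability P Z l.
Proof.
move=> mZ Zq cl q0; split => // eps e0.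
have e20 : 0 < eps / 2 by rewrite divr_gt0.
have cn : \forall m \near \oo, `|l - c m| < eps / 2.
  by move/cvgrPdist_lt : cl => /(_ _ e20).
apply: (squeeze_cvge (f := fun=> 0%E)
  (h := fun m => (q m / (eps / 2) ^+ 2)%:E)).
- near=> m; rewrite measure_ge0/=.
  have cm : `|l - c m| < eps / 2 by near: m.
  have Zqm : has_mean (P m) (fun w => (Z m w - c m) ^+ 2) (q m) by near: m.
  apply: le_trans (chebyshev_has_mean e20 (mZ m) Zqm).
  apply: le_measure; rewrite ?inE; [exact: measurable_dist_event..|].
  move=> w /= ew; rewrite leNgt; apply/negP => Zc.
  move: ew; rewrite leNgt => /negP; apply.
  rewrite (_ : _ - l = (Z m w - c m) - (l - c m)); last by ring.
  by rewrite (le_lt_trans (ler_normB _ _))// [eps]splitr ltrD.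
- exact: cvg_cst.
- apply: cvg_EFin; first exact: nearW.
  rewrite -(mul0r ((eps / 2) ^+ 2)^-1); apply: cvgM => //.
  exact: cvg_cst.
Unshelve. all: by end_near.
Qed.

End convergence_in_probability.

(** * The sample means *)

Section two_sample_errors.
Context {R : realType} d (T : measurableType d) (P : probability T R).
Variables (p n1 n2 : nat) (mu1 mu2 : 'cV[R]_p) (S : 'M[R]_p).
Variables (X1 : 'I_n1 -> T -> 'cV[R]_p) (X2 : 'I_n2 -> T -> 'cV[R]_p).
Hypotheses (Scov : covariance_matrix S) (Sunit : S \in unitmx).
Hypothesis X1_normal : forall j, normal_vector P (X1 j) mu1 S.
Hypothesis X2_normal : forall j, normal_vector P (X2 j) mu2 S.
Hypothesis X_indep : independent_vectors P (two_samples X1 X2).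

Definition error_combination (a b : R) (w : T) : 'cV[R]_p :=
  a *: (sample_mean X1 w - mu1) + b *: (sample_mean X2 w - mu2).

Lemma measurable_error_combination a b i :
  measurable_fun setT (fun w => error_combination a b w i 0).
Proof.
have mS n (X : 'I_n -> T -> 'cV[R]_p) (mu : 'cV[R]_p) (c : R) :
    (forall j, normal_vector P (X j) mu S) ->
    measurable_fun setT (fun w =>
      c * (n%:R^-1 * (\sum_(j < n) X j w i 0) - mu i 0)).
  move=> XN; apply: measurable_funM => //; apply: measurable_funB => //.
  apply: measurable_funM => //; apply: measurable_sum => j.
  by have [] := XN j.
rewrite (_ : (fun w => _) = (fun w =>
    a * (n1%:R^-1 * (\sum_(j < n1) X1 j w i 0) - mu1 i 0) +
    b * (n2%:R^-1 * (\sum_(j < n2) X2 j w i 0) - mu2 i 0))).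
  by apply: measurable_funD; exact: mS.
by apply/funext => w; rewrite !mxE !summxE.
Qed.

Lemma measurable_bilin (A : 'M[R]_p) (x y : T -> 'cV[R]_p) :
  (forall i, measurable_fun setT (fun w => x w i 0)) ->
  (forall i, measurable_fun setT (fun w => y w i 0)) ->
  measurable_fun setT (fun w => bilin (x w) A (y w)).
Proof.
move=> mx my; rewrite /bilin.
rewrite (_ : (fun w => _) =
  (fun w => \sum_i (\sum_j x w j 0 * A j i) * y w i 0)).
  apply: measurable_sum => i; apply: measurable_funM => //.
  by apply: measurable_sum => j; exact: measurable_funM.
apply/funext => w; rewrite mxE; apply: eq_bigr => i _; rewrite mxE.
by congr (_ * _); apply: eq_bigr => j _; rewrite mxE.
Qed.

Variables (a b : R).
Hypotheses (n1_gt0 : (0 < n1)%N) (n2_gt0 : (0 < n2)%N).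

Let mu (i : 'I_n1 + 'I_n2) := if i is inl _ then mu1 else mu2.
Let c (i : 'I_n1 + 'I_n2) := if i is inl _ then a / n1%:R else b / n2%:R.

(** Positivity of [n] matters: an empty sample has mean 0 and hence error [- m], while the sum is
    0. *)
Let sum_mean n (X : 'I_n -> T -> 'cV[R]_p) m (k : R) w : (0 < n)%N ->
  \sum_(j < n) (k / n%:R) *: (X j w - m) = k *: (sample_mean X w - m).
Proof.
move=> n0; rewrite -scaler_sumr sumrB sumr_const card_ord -scalerA.
congr (_ *: _).
rewrite scalerBr /sample_mean -[m *+ n]scaler_nat [X in _ - X]scalerA.
by rewrite mulVf ?scale1r// pnatr_eq0 -lt0n.
Qed.

Let error_combinationE w :
  centered_sum (two_samples X1 X2) mu c w = error_combination a b w.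
Proof. by rewrite /centered_sum big_sumType/= !sum_mean. Qed.

Let two_samples_normal i : normal_vector P (two_samples X1 X2 i) (mu i) S.
Proof. by case: i. Qed.

Let sum_weights : \sum_i c i ^+ 2 = a ^+ 2 / n1%:R + b ^+ 2 / n2%:R.
Proof.
have N (n : nat) (k : R) : (0 < n)%N ->
    \sum_(j < n) (k / n%:R) ^+ 2 = k ^+ 2 / n%:R.
  move=> n0; rewrite sumr_const card_ord -[LHS]mulr_natl.
  by field; rewrite pnatr_eq0 -lt0n.
by rewrite big_sumType/= !N.
Qed.

Lemma has_mean_error_quadratic :
  has_mean P (fun w =>
      (bilin (error_combination a b w) (invmx S) (error_combination a b w) -
      (a ^+ 2 / n1%:R + b ^+ 2 / n2%:R) * p%:R) ^+ 2)
    (2 * p%:R * (a ^+ 2 / n1%:R + b ^+ 2 / n2%:R) ^+ 2).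
Proof.
have := has_mean_quadratic_form c Scov Sunit two_samples_normal X_indep.
by under eq_fun do rewrite error_combinationE; rewrite sum_weights.
Qed.

(** This is the linear form of [a = S^-1 x], for which [a^T S a = x^T S^-1 x]. *)
Lemma has_mean_error_linear (x : 'cV[R]_p) :
  has_mean P (fun w => bilin x (invmx S) (error_combination a b w) ^+ 2)
    ((a ^+ 2 / n1%:R + b ^+ 2 / n2%:R) * bilin x (invmx S) x).
Proof.
have iST : (invmx S)^T = invmx S by rewrite trmx_inv Scov.1.
have := gaussian_moments_centered_sum c Scov two_samples_normal X_indep
  (invmx S *m x).
rewrite bilin_mulmx iST mulVmx// mul1mx sum_weights => -[_ h _ _].
apply: eq_has_mean h => w; rewrite error_combinationE.
by rewrite trmx_mul iST.
Qed.

End two_sample_errors.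

Lemma cvg_natr_inv (R : realType) (n : nat -> nat) :
  n @ \oo --> \oo -> ((n m)%:R^-1 : R) @[m --> \oo] --> (0 : R).
Proof.
move=> noo; apply: (cvg_comp n (fun k : nat => k%:R^-1 : R)); first exact: noo.
apply/gtr0_cvgV0; last exact: cvgr_idn.
by exists 1%N => // k /=; rewrite ltr0n.
Qed.

(** Both scores are differences of squares, [|dl - v|^2 - |u|^2] and [|dl + u|^2 - |v|^2] up to the
    factors 1/2 and -1/2, so the cross term of [u] and [v] cancels in them; it survives only in the
    third form, inside [|u - v|^2]. *)
Lemma discriminant_scoreE (R : realType) p (A : 'M[R]_p)
    (mu1 mu2 x1 x2 : 'cV[R]_p) :
  A^T = A ->
  let u := x1 - mu1 in let v := x2 - mu2 in let dl := mu1 - mu2 in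
  [/\ bilin (mu1 - 2^-1 *: (x1 + x2)) A (x1 - x2) =
      2^-1 * (bilin dl A dl - 2 * bilin dl A v - bilin u A u + bilin v A v),
      bilin (mu2 - 2^-1 *: (x1 + x2)) A (x1 - x2) =
      - 2^-1 * (bilin dl A dl + 2 * bilin dl A u + bilin u A u - bilin v A v) &
      bilin (x1 - x2) A (x1 - x2) =
      bilin dl A dl + 2 * bilin dl A u - 2 * bilin dl A v +
      bilin (u - v) A (u - v)].
Proof.
move=> AT u v dl.
have e0 : x1 - x2 = dl + u - v.
  by apply/colP => i; rewrite !mxE; ring.
have e1 : mu1 - 2^-1 *: (x1 + x2) = 2^-1 *: (dl - u - v).
  by apply/colP => i; rewrite !mxE; field.
have e2 : mu2 - 2^-1 *: (x1 + x2) = - 2^-1 *: (dl + u + v).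
  by apply/colP => i; rewrite !mxE; field.
clearbody u v dl.
rewrite e0 e1 e2 !bilinZl !(bilinDl, bilinDr, bilinNl, bilinNr).
rewrite (bilinC u dl AT) (bilinC v dl AT) (bilinC v u AT).
by split; field.
Qed.

Unset Implicit Arguments.
Set Strict Implicit.
Set Printing Implicit Defensive.

Theorem theorem2p1 (R : realType)
    (* dimensions, sample sizes and parameters of the m-th problem *)
    (p n1 n2 : nat -> nat)
    (mu1 mu2 : forall m : nat, 'cV[R]_(p m))
    (Sigma : forall m : nat, 'M[R]_(p m))
    (* the training samples *)
    (d : nat -> measure_display) (T : forall m : nat, measurableType (d m))
    (P : forall m : nat, probability (T m) R)
    (X1 : forall m : nat, 'I_(n1 m) -> T m -> 'cV[R]_(p m))
    (X2 : forall m : nat, 'I_(n2 m) -> T m -> 'cV[R]_(p m))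
    (* the new observation, from class 1 or from class 2 *)
    (d' : nat -> measure_display) (T' : forall m : nat, measurableType (d' m))
    (Q : forall m : nat, probability (T' m) R)
    (Y1 Y2 : forall m : nat, T' m -> 'cV[R]_(p m))
    (Delta y1 y2 : R)
    (p_infty : p @ \oo --> \oo)
    (n1_infty : n1 @ \oo --> \oo)
    (n2_infty : n2 @ \oo --> \oo)
    (mu_neq : forall m : nat, mu1 m <> mu2 m)
    (Sigma_cov : forall m : nat, covariance_matrix (Sigma m))
    (Sigma_unit : forall m : nat, Sigma m \in unitmx)
    (X1_normal : forall (m : nat) (j : 'I_(n1 m)),
       normal_vector (P m) (X1 m j) (mu1 m) (Sigma m))
    (X2_normal : forall (m : nat) (j : 'I_(n2 m)),
       normal_vector (P m) (X2 m j) (mu2 m) (Sigma m))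
    (X_indep : forall m : nat,
       independent_vectors (P m) (two_samples (X1 m) (X2 m)))
    (Y1_normal : forall m : nat,
       normal_vector (Q m) (Y1 m) (mu1 m) (Sigma m))
    (Y2_normal : forall m : nat,
       normal_vector (Q m) (Y2 m) (mu2 m) (Sigma m))
    (y1_gt0 : 0 < y1) (y2_gt0 : 0 < y2)
    (pn1_cvg : (p m)%:R / (n1 m)%:R @[m --> \oo] --> y1)
    (pn2_cvg : (p m)%:R / (n2 m)%:R @[m --> \oo] --> y2)
    (Delta_const : forall m : nat,
       Delta =
       Num.sqrt (bilin (mu1 m - mu2 m) (invmx (Sigma m)) (mu1 m - mu2 m))) :
  let R_LDA1 (m : nat) (w : T m) : R :=
    lda1_rate (Q m) (Y1 m) (Y2 m) (Sigma m)
      (sample_mean (X1 m) w) (sample_mean (X2 m) w) in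
  (forall (m : nat) (w : T m),
     R_LDA1 m w = lda1_formula (mu1 m) (mu2 m) (Sigma m)
                    (sample_mean (X1 m) w) (sample_mean (X2 m) w)) /\
  cvg_in_probability P R_LDA1
    (2^-1 * Phi (- ((Delta ^+ 2 + y2 - y1)
                    / (2 * Num.sqrt (Delta ^+ 2 + y1 + y2)))) +
     2^-1 * Phi (- ((Delta ^+ 2 + y1 - y2)
                    / (2 * Num.sqrt (Delta ^+ 2 + y1 + y2))))).
Proof.
move=> R_LDA1.
have R_LDA1E m w : R_LDA1 m w = lda1_formula (mu1 m) (mu2 m) (Sigma m)
    (sample_mean (X1 m) w) (sample_mean (X2 m) w).
  exact: lda1_rateE.
split => //.
have iST m : (invmx (Sigma m))^T = invmx (Sigma m).
  by rewrite trmx_inv (Sigma_cov m).1.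
pose dl m := mu1 m - mu2 m.
have dlE m : bilin (dl m) (invmx (Sigma m)) (dl m) = Delta ^+ 2.
  rewrite (Delta_const m) sqr_sqrtr//.
  have [A [_ ->]] := covariance_whitening (Sigma_cov m) (Sigma_unit m).
  rewrite -(mulmx1 A^T) -bilin_mulmx bilin1 sumr_ge0// => i _.
  by rewrite -expr2 sqr_ge0.
pose e a b m w := error_combination (mu1 m) (mu2 m) (X1 m) (X2 m) a b w.
pose s (a b : R) m := a ^+ 2 / (n1 m)%:R + b ^+ 2 / (n2 m)%:R.
have mE a b m i : measurable_fun setT (fun w => e a b m w i 0).
  exact: measurable_error_combination (X1_normal m) (X2_normal m) _ _ _.
have n1_gt0 : \forall m \near \oo, (0 < n1 m)%N.
  by apply: (n1_infty [set k | (0 < k)%N]); exists 1%N.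
have n2_gt0 : \forall m \near \oo, (0 < n2 m)%N.
  by apply: (n2_infty [set k | (0 < k)%N]); exists 1%N.
have s0 a b : s a b @ \oo --> (0 : R).
  rewrite -[0]addr0 -[X in _ --> X + _](mulr0 (a ^+ 2)).
  rewrite -[X in _ --> _ + X](mulr0 (b ^+ 2)).
  by apply: cvgD; apply: cvgM; [exact: cvg_cst|exact: cvg_natr_inv|
    exact: cvg_cst|exact: cvg_natr_inv].
have sp a b : s a b m * (p m)%:R @[m --> \oo] --> a ^+ 2 * y1 + b ^+ 2 * y2.
  rewrite (_ : (fun m => _) = (fun m => a ^+ 2 * ((p m)%:R / (n1 m)%:R) +
      b ^+ 2 * ((p m)%:R / (n2 m)%:R))); last first.
    by apply/funext => m; rewrite /s mulrDl; congr (_ + _);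
      rewrite mulrAC mulrA.
  by apply: cvgD; apply: cvgM => //; exact: cvg_cst.
(* Used at (1, 0), (0, 1) and (1, -1), with limits [y1], [y2] and [y1 + y2]. *)
have quad a b : cvg_in_probability P
    (fun m w => bilin (e a b m w) (invmx (Sigma m)) (e a b m w))
    (a ^+ 2 * y1 + b ^+ 2 * y2).
  apply: (cvg_in_probability_L2 (c := fun m => s a b m * (p m)%:R)
    (q := fun m => 2 * (p m)%:R * s a b m ^+ 2)) => //.
  - by move=> m; exact: measurable_bilin.
  - near=> m.
    have n1m : (0 < n1 m)%N by near: m.
    have n2m : (0 < n2 m)%N by near: m.
    exact: (has_mean_error_quadratic (Sigma_cov m) (Sigma_unit m)
      (X1_normal m) (X2_normal m) (X_indep m) _ _ n1m n2m).
  (* The variance is split into the convergent factor [s p] and the vanishing factor [s]. *)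
  - rewrite (_ : (fun m => _) = (fun m => 2 * (s a b m * (p m)%:R) * s a b m)).
      rewrite -(mulr0 (2 * (a ^+ 2 * y1 + b ^+ 2 * y2))).
      by apply: cvgM => //; apply: cvgM => //; exact: cvg_cst.
    by apply/funext => m; ring.
have lin a b : cvg_in_probability P
    (fun m w => bilin (dl m) (invmx (Sigma m)) (e a b m w)) 0.
  apply: (cvg_in_probability_L2 (c := fun=> 0)
    (q := fun m => s a b m * Delta ^+ 2)).
  - by move=> m; apply: measurable_bilin => // i; exact: measurable_cst.
  - near=> m.
    have n1m : (0 < n1 m)%N by near: m.
    have n2m : (0 < n2 m)%N by near: m.
    under eq_fun do rewrite subr0.
    rewrite -(dlE m).
    exact: (has_mean_error_linear (Sigma_cov m) (Sigma_unit m)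
      (X1_normal m) (X2_normal m) (X_indep m) _ _ n1m n2m).
  - exact: cvg_cst.
  - rewrite -(mul0r (Delta ^+ 2)); apply: cvgM => //; exact: cvg_cst.
have e10 m w : sample_mean (X1 m) w - mu1 m = e 1 0 m w.
  by rewrite /e /error_combination scale1r scale0r addr0.
have e01 m w : sample_mean (X2 m) w - mu2 m = e 0 1 m w.
  by rewrite /e /error_combination scale1r scale0r add0r.
have e1N1 m w : e 1 0 m w - e 0 1 m w = e 1 (-1) m w.
  by rewrite -e10 -e01 /e /error_combination scale1r scaleN1r.
have Dc := cvg_in_probability_cst P (Delta ^+ 2).
(* The squared errors enter with opposite signs, hence [y2 - y1]; the linear term tends to 0. *)
have U1 : cvg_in_probability P (fun m w =>
    (-1) ^+ 1 * bilin (mu1 m -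
        2^-1 *: (sample_mean (X1 m) w + sample_mean (X2 m) w))
      (invmx (Sigma m)) (sample_mean (X1 m) w - sample_mean (X2 m) w))
    (- 2^-1 * (Delta ^+ 2 + y2 - y1)).
  have := cvg_in_probabilityZ (- 2^-1) (cvg_in_probabilityD
    (cvg_in_probabilityD Dc (cvg_in_probabilityZ (- 2) (lin 0 1)))
    (cvg_in_probabilityD (cvg_in_probabilityZ (- 1) (quad 1 0)) (quad 0 1))).
  apply: eq_cvg_in_probability => [|m w]; first by ring.
  have [-> _ _] := discriminant_scoreE (mu1 m) (mu2 m) (sample_mean (X1 m) w)
    (sample_mean (X2 m) w) (iST m).
  by rewrite e10 e01 -/(dl m) dlE; ring.
have U2 : cvg_in_probability P (fun m w =>
    (-1) ^+ 2 * bilin (mu2 m -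
        2^-1 *: (sample_mean (X1 m) w + sample_mean (X2 m) w))
      (invmx (Sigma m)) (sample_mean (X1 m) w - sample_mean (X2 m) w))
    (- 2^-1 * (Delta ^+ 2 + y1 - y2)).
  have := cvg_in_probabilityZ (- 2^-1) (cvg_in_probabilityD
    (cvg_in_probabilityD Dc (cvg_in_probabilityZ 2 (lin 1 0)))
    (cvg_in_probabilityD (quad 1 0) (cvg_in_probabilityZ (- 1) (quad 0 1)))).
  apply: eq_cvg_in_probability => [|m w]; first by ring.
  have [_ -> _] := discriminant_scoreE (mu1 m) (mu2 m) (sample_mean (X1 m) w)
    (sample_mean (X2 m) w) (iST m).
  by rewrite e10 e01 -/(dl m) dlE; ring.
have V : cvg_in_probability P (fun m w =>
    bilin (sample_mean (X1 m) w - sample_mean (X2 m) w)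
      (invmx (Sigma m)) (sample_mean (X1 m) w - sample_mean (X2 m) w))
    (Delta ^+ 2 + y1 + y2).
  have := cvg_in_probabilityD
    (cvg_in_probabilityD Dc (cvg_in_probabilityZ 2 (lin 1 0)))
    (cvg_in_probabilityD (cvg_in_probabilityZ (- 2) (lin 0 1)) (quad 1 (-1))).
  apply: eq_cvg_in_probability => [|m w]; first by ring.
  have [_ _ ->] := discriminant_scoreE (mu1 m) (mu2 m) (sample_mean (X1 m) w)
    (sample_mean (X2 m) w) (iST m).
  by rewrite e10 e01 e1N1 -/(dl m) dlE; ring.
have V_gt0 : 0 < Delta ^+ 2 + y1 + y2.
  by rewrite -addrA ltr_wpDl ?sqr_ge0// addr_gt0.
have := cvg_in_probabilityZ 2^-1 (cvg_in_probabilityD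
  (cvg_in_probability_Phi V_gt0 U1 V) (cvg_in_probability_Phi V_gt0 U2 V)).
have half (x : R) : - 2^-1 * x / Num.sqrt (Delta ^+ 2 + y1 + y2) =
    - (x / (2 * Num.sqrt (Delta ^+ 2 + y1 + y2))).
  by rewrite invfM mulNr mulNr mulrCA mulrA.
apply: eq_cvg_in_probability => [|m w]; last by rewrite R_LDA1E.
by rewrite mulrDr !half.
Unshelve. all: by end_near.
Qed.
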